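(* Let $k\ge 2$ be an integer and let $\varepsilon>0$. There exists $\Delta_0\in\mathbb{N}$ such that for every $\Delta\ge\Delta_0$ and every $n$, every $n$-vertex $k$-uniform uncrowded hypergraph $\mathcal{H}$ of maximum degree at most $\Delta$ satisfies $$\chi_\ell(\mathcal{H})\le(1+\varepsilon)\left((k-1)\,\frac{\Delta}{\log\Delta}\right)^{\frac{1}{k-1}}.$$
   Context: A hypergraph is a pair $(V,E)$ with $V$ a finite set and $E\subseteq 2^V$; it is $k$-uniform if every edge has exactly $k$ elements. The degree of a vertex is the number of edges containing it. For $r\ge2$, an $r$-cycle consists of $r$ distinct edges $e_0,\dots,e_{r-1}$ for which there are distinct vertices $v_1,\dots,v_r$ with $v_i\in e_i\cap e_{i+1}$ for $1\le i\le r$ (indices modulo $r$). A hypergraph is uncrowded if it contains no $r$-cycle for $2\le r\le4$ (i.e. girth at least $5$). A proper coloring assigns colors to vertices so that no edge is monochromatic. The list chromatic number $\chi_\ell(\mathcal{H})$ is the minimum integer $q$ such that whenever each vertex $v$ is given a list $L(v)\subseteq\mathbb{N}$ with $|L(v)|\ge q$, there is a proper coloring of $\mathcal{H}$ in which every vertex $v$ receives a color from $L(v)$. $\log$ is the natural logarithm. *)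

(* Defs.v *)
From mathcomp Require Import all_boot all_classical.

Set Implicit Arguments.
Unset Strict Implicit.
Unset Printing Implicit Defensive.

(* A hypergraph on the vertex set V is given by its edge set H : {set {set V}}. *)

Definition uniform (k : nat) (V : finType) (H : {set {set V}}) : Prop :=
  forall e, e \in H -> #|e| = k.

Definition degree (V : finType) (H : {set {set V}}) (v : V) : nat :=
  #|[set e in H | v \in e]%SET|.

Definition max_degree (V : finType) (H : {set {set V}}) : nat :=
  \max_(v : V) degree H v.

(* Indices are taken modulo r: ordS i is i + 1 mod r, and ord 0 plays the role
   of the index r.  Intended for r >= 2. *)
Definition has_cycle (V : finType) (H : {set {set V}}) (r : nat) : Prop :=
  exists (e : 'I_r -> {set V}) (v : 'I_r -> V),
    [/\ injective e, injective v, (forall i, e i \in H)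
      & forall i, v i \in e i :&: e (ordS i)].

Definition uncrowded (V : finType) (H : {set {set V}}) : Prop :=
  forall r, 2 <= r <= 4 -> ~ has_cycle H r.

Definition monochromatic (V : finType) (f : V -> nat) (e : {set V}) : Prop :=
  exists c, forall v, v \in e -> f v = c.

Definition proper_coloring (V : finType) (H : {set {set V}}) (f : V -> nat)
    : Prop :=
  forall e, e \in H -> ~ monochromatic f e.

(* Lists are arbitrary, possibly infinite, sets of naturals; `I_q #<= L v says
   that L v has at least q elements. *)
Definition choosable (V : finType) (H : {set {set V}}) (q : nat) : Prop :=
  forall L : V -> set nat, (forall v, `I_q #<= L v)%card ->
    exists2 f : V -> nat, proper_coloring H f & forall v, L v (f v).

Definition is_list_chromatic_number (V : finType) (H : {set {set V}}) (q : nat)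
    : Prop :=
  choosable H q /\ forall p, choosable H p -> q <= p.

(* The value 0 is a junk value when no such q exists; this does not happen if
   all edges have at least two vertices, see list_chromatic_numberP. *)
Definition list_chromatic_number (V : finType) (H : {set {set V}}) : nat :=
  xget 0 [set q | is_list_chromatic_number H q]%classic.

Lemma list_distinct_representatives (V : finType) (L : V -> set nat) :
  (forall v, `I_#|V| #<= L v)%card ->
  exists2 f : V -> nat, injective f & forall v, L v (f v).
Proof.
move=> HL.
suff /(_ (enum V)) [|f injf Lf] : forall s : seq V, uniq s ->
    exists2 f : V -> nat, {in s &, injective f} &
                          forall v, v \in s -> L v (f v).
- exact: enum_uniq.
- exists f => [x y|v]; last by apply: Lf; rewrite mem_enum.
  by apply: injf; rewrite mem_enum.
elim=> [|x s IH] /=; first by move=> _; exists (fun=> 0).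
case/andP=> xs us; have [f injf Lf] := IH us.
have [c Lc cs] : exists2 c, L x c & c \notin [seq f y | y <- s].
  apply: contrapT => nc.
  have sub : (L x `<=` [set` [seq f y | y <- s]])%classic.
    by move=> c Lc /=; apply: contrapT => /negP cs; apply: nc; exists c.
  set t := [seq f y | y <- s] in sub.
  have tI : ([set` t] `<=` nth 0 t @` `I_(size t))%classic.
    by move=> c ct; exists (index c t); [rewrite /= index_mem | exact: nth_index].
  have le_n : (`I_#|V| #<= `I_(size t))%card.
    apply: card_le_trans (HL x) _.
    apply: card_le_trans (subset_card_le (subset_trans sub tI)) _.
    exact: card_image_le.
  move: le_n; rewrite card_le_II size_map leqNgt => /negP; apply.
  have : uniq (x :: s) by rewrite /= xs.
  by move/card_uniqP => /= <-; exact: max_card.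
have fc y : y \in s -> f y <> c.
  by move=> ys fy; move/negP: cs; apply; rewrite -fy map_f.
exists (fun y => if y == x then c else f y) => [y z|y].
- rewrite !inE; case: eqVneq => [->|yx] /=; case: eqVneq => [->|zx] //= ys zs.
  + by move=> /esym /fc; case.
  + by move=> /fc; case.
  + exact: injf.
- by rewrite inE; case: eqVneq => [->|_] //=; apply: Lf.
Qed.

Lemma choosable_card (V : finType) (H : {set {set V}}) :
  (forall e, e \in H -> 2 <= #|e|) -> choosable H #|V|.
Proof.
move=> H2 L /list_distinct_representatives[f injf Lf]; exists f => // e eH [c fc].
have /card_gt1P[x [y [xe ye]]] := H2 _ eH.
by apply/negP; rewrite negbK; apply/eqP/injf; rewrite !fc.
Qed.

Lemma list_chromatic_numberP (V : finType) (H : {set {set V}}) :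
  (forall e, e \in H -> 2 <= #|e|) ->
  is_list_chromatic_number H (list_chromatic_number H).
Proof.
move=> /choosable_card cV; rewrite /list_chromatic_number.
have ex : exists q, `[< choosable H q >] by exists #|V|; apply/asboolP.
case: xgetP => [q -> //|/(_ (ex_minn ex)) []].
case: ex_minnP => m /asboolP cm mmin; split=> // p cp.
by apply: mmin; apply/asboolP.
Qed.

(* Main.v *)
Require Import Defs.
From mathcomp Require Import all_boot all_order all_algebra.
From mathcomp Require Import all_classical all_reals all_analysis.
From mathcomp Require Import ring lra.
Import Order.TTheory GRing.Theory Num.Theory.
Local Open Scope ring_scope.
Set Implicit Arguments.
Unset Strict Implicit.
Unset Printing Implicit Defensive.

(* A semi-random colouring in small steps.  Write [K = k - 1].  Keep a partial
   proper colouring, and for each vertex a list of exactly [l] colours that are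
   still usable; a vertex is live while uncoloured.  In one round every live
   vertex independently tries, with small probability [theta], a uniform colour
   of its list; it keeps it unless some edge would become monochromatic.  Colours
   that become forbidden are deleted, and extra coin flips delete further colours
   so that all colours of all lists survive with the same probability.

   With [x] the proportion of coloured vertices, a vertex [v] and a colour [c] of
   its list see about [lam * 'C(K, m) * (1 - x)^m * x^(K-m) * l^m] edges whose
   other vertices are either coloured [c] or among [m] live ones with [c] in their
   list.  Since cycles of length 2, 3 and 4 are absent, different edges at [v]
   evolve independently, so these numbers and the list sizes are concentrated, and
   the Lovasz local lemma gives an outcome that is good at every vertex.  The rate
   of deletion telescopes to [lam * x^K], so the lists shrink by a factor at least
   [exp (- lam)] in total, which leaves a power of [Delta] many colours exactly
   because [K * lam < log Delta].  Once the live proportion is a small power of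
   [1 / log Delta], a last application of the local lemma colours all remaining
   vertices at once. *)

(** * Finite product measures *)

Section ProductMeasure.
Variables (R : realType) (I T : finType) (mu : I -> T -> R).
Hypothesis mu_ge0 : forall i t, 0 <= mu i t.
Hypothesis mu_sum1 : forall i, \sum_t mu i t = 1.
Local Notation Om := {ffun I -> T}.

Definition weight (w : Om) : R := \prod_i mu i (w i).
Definition expect (f : Om -> R) : R := \sum_w weight w * f w.
Definition proba (A : pred Om) : R := expect (fun w => (A w)%:R).

Definition depends_on (X : Type) (A : {set I}) (f : Om -> X) : Prop :=
  forall w w' : Om, (forall i, i \in A -> w i = w' i) -> f w = f w'.

Lemma weight_ge0 w : 0 <= weight w.
Proof. exact: prodr_ge0. Qed.

Lemma eq_expect f g : f =1 g -> expect f = expect g.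
Proof. by move=> fg; apply: eq_bigr => w _; rewrite fg. Qed.

Lemma expect_prod_coord (g : I -> T -> R) :
  expect (fun w => \prod_i g i (w i)) = \prod_i \sum_t mu i t * g i t.
Proof.
rewrite bigA_distr_bigA /=; apply: eq_bigr => w _.
by rewrite /weight -big_split.
Qed.

Lemma expect1 : expect (fun=> 1) = 1.
Proof.
transitivity (expect (fun=> \prod_(i : I) 1)).
  by apply: eq_expect => w; rewrite big1.
rewrite (expect_prod_coord (fun _ _ => 1)) big1 // => i _.
by rewrite -[RHS](mu_sum1 i); apply: eq_bigr => t _; rewrite mulr1.
Qed.

Lemma expectZ a f : expect (fun w => a * f w) = a * expect f.
Proof. by rewrite /expect mulr_sumr; apply: eq_bigr => w _; rewrite mulrCA. Qed.

Lemma expectD f g : expect (fun w => f w + g w) = expect f + expect g.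
Proof. by rewrite /expect -big_split; apply: eq_bigr => w _; rewrite mulrDr. Qed.

Lemma expectB f g : expect (fun w => f w - g w) = expect f - expect g.
Proof. by rewrite /expect -sumrB; apply: eq_bigr => w _; rewrite mulrBr. Qed.

Lemma expect_cst a : expect (fun=> a) = a.
Proof.
transitivity (expect (fun=> a * 1)); first by apply: eq_expect => w; rewrite mulr1.
by rewrite expectZ expect1 mulr1.
Qed.

Lemma expect_sum (J : finType) (P : pred J) (f : J -> Om -> R) :
  expect (fun w => \sum_(j | P j) f j w) = \sum_(j | P j) expect (f j).
Proof.
rewrite /expect exchange_big /=; apply: eq_bigr => w _.
by rewrite mulr_sumr.
Qed.

Lemma expect_le f g : (forall w, f w <= g w) -> expect f <= expect g.
Proof. by move=> fg; apply: ler_sum => w _; rewrite ler_wpM2l ?weight_ge0. Qed.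

Lemma expect_ge0 f : (forall w, 0 <= f w) -> 0 <= expect f.
Proof. by move=> f0; apply: sumr_ge0 => w _; rewrite mulr_ge0 ?weight_ge0. Qed.

Lemma eq_proba (A B : pred Om) : A =1 B -> proba A = proba B.
Proof. by move=> AB; apply: eq_expect => w; rewrite AB. Qed.

Lemma proba_ge0 (A : pred Om) : 0 <= proba A.
Proof. by apply: expect_ge0 => w. Qed.

Lemma proba_le (A B : pred Om) : (forall w, A w -> B w) -> proba A <= proba B.
Proof.
move=> AB; apply: expect_le => w; rewrite ler_nat.
by case: (A w) (AB w) => //= ->.
Qed.

Lemma probaU (A B : pred Om) : proba (fun w => A w || B w) <= proba A + proba B.
Proof.
rewrite -expectD; apply: expect_le => w; rewrite -natrD ler_nat.
by case: (A w); case: (B w).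
Qed.

Lemma proba_exists (J : finType) (P : pred J) (A : J -> pred Om) :
  proba (fun w => [exists j, P j && A j w]) <= \sum_(j | P j) proba (A j).
Proof.
rewrite -expect_sum; apply: expect_le => w.
case: existsP => [[j /andP[Pj Aj]]|_]; last by rewrite sumr_ge0.
by rewrite (bigD1 j) //= Aj lerDl sumr_ge0.
Qed.

Lemma proba_coord i (B : pred T) :
  proba (fun w => B (w i)) = \sum_(t | B t) mu i t.
Proof.
pose g j t : R := if j == i then (B t)%:R else 1.
have -> : proba (fun w => B (w i)) = expect (fun w => \prod_j g j (w j)).
  apply: eq_expect => w; rewrite (bigD1 i) //= /g eqxx big1 ?mulr1 // => j ji.
  by rewrite (negbTE ji).
rewrite expect_prod_coord /g (bigD1 i) //= [X in _ * X]big1 ?mulr1 => [|j ji].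
  by rewrite eqxx [RHS]big_mkcond; apply: eq_bigr => t _; case: (B t);
    rewrite ?mulr1 ?mulr0.
by rewrite (negbTE ji) -[RHS](mu_sum1 j); apply: eq_bigr => t _; rewrite mulr1.
Qed.

(* Exchanging the coordinates in [A] of two independent copies preserves the
   product measure and turns [f w * g w'] into [f * g] at a single point. *)
Lemma expect_indep (A B : {set I}) (f g : Om -> R) :
  depends_on A f -> depends_on B g -> [disjoint A & B] ->
  expect (fun w => f w * g w) = expect f * expect g.
Proof.
move=> df dg dAB.
pose mix (w w' : Om) : Om := [ffun i => if i \in A then w i else w' i].
pose h (u : Om * Om) := (mix u.1 u.2, mix u.2 u.1).
have hK : involutive h.
  by case=> w w'; rewrite /h /=; congr (_, _); apply/ffunP => i; rewrite !ffunE;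
    case: (i \in A).
have -> : expect f * expect g =
    \sum_(u : Om * Om) (weight u.1 * weight u.2) * (f u.1 * g u.2).
  rewrite /expect mulr_suml.
  rewrite -(pair_bigA _ (fun w w' => weight w * weight w' * (f w * g w'))) /=.
  apply: eq_bigr => w _; rewrite mulr_sumr; apply: eq_bigr => w' _.
  by rewrite mulrACA.
rewrite [RHS](reindex_inj (inv_inj hK)) /=.
have wE (u : Om * Om) : weight (h u).1 * weight (h u).2 = weight u.1 * weight u.2.
  rewrite /weight -!big_split /=; apply: eq_bigr => i _.
  by rewrite /= !ffunE; case: ifP => // _; rewrite mulrC.
rewrite (eq_bigr (fun u => weight u.1 * weight u.2 * (f u.1 * g u.1))); last first.
  move=> [w w'] _; rewrite wE /=; congr (_ * (_ * _)).
    by apply: df => i iA; rewrite ffunE iA.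
  apply: dg => i iB; rewrite ffunE; case: ifP => // iA.
  by move: (disjointFr dAB iA); rewrite iB.
rewrite -(pair_bigA _ (fun w w' => weight w * weight w' * (f w * g w))) /=.
apply: eq_bigr => w _.
rewrite (eq_bigr (fun w' => weight w * (f w * g w) * weight w')); last first.
  by move=> w' _; ring.
rewrite -mulr_sumr -[X in _ = _ * X]/(\sum_w' weight w') .
have -> : \sum_w' weight w' = 1.
  by rewrite -[RHS]expect1; apply: eq_bigr => w' _; rewrite mulr1.
by rewrite mulr1.
Qed.

Lemma expect_prod_indep (J : finType) (P : pred J) (A : J -> {set I})
    (f : J -> Om -> R) :
  (forall j, P j -> depends_on (A j) (f j)) ->
  (forall i j, P i -> P j -> i != j -> [disjoint A i & A j]) ->
  expect (fun w => \prod_(j | P j) f j w) = \prod_(j | P j) expect (f j).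
Proof.
move=> df dA.
pose S := [set j | P j].
have Pin j : P j = (j \in S) by rewrite inE.
rewrite (eq_bigl (mem S)) //.
under eq_expect => w do rewrite (eq_bigl (mem S)) //.
have {}df j : j \in S -> depends_on (A j) (f j) by rewrite -Pin; exact: df.
have {}dA i j : i \in S -> j \in S -> i != j -> [disjoint A i & A j].
  by rewrite -!Pin; exact: dA.
(* That the partial product depends only on the union of the [A j] is carried through the induction,
   since splitting off one more factor by [expect_indep] needs it. *)
suff [] : (expect (fun w => \prod_(j in S) f j w) = \prod_(j in S) expect (f j)) /\
   depends_on (\bigcup_(j in S) A j) (fun w => \prod_(j in S) f j w) by [].
clear Pin; clearbody S.
have [n] := ubnP #|S|; elim: n S df dA => // n IH S df dA; rewrite ltnS => Sn.
have [->|[j jS]] := set_0Vmem S.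
  split; last by move=> w w' _; rewrite !big_set0.
  by rewrite big_set0 -[RHS]expect1; apply: eq_expect => w; rewrite big_set0.
have [|||e d] := IH (S :\ j).
- by move=> i; rewrite inE => /andP[_]; exact: df.
- by move=> i i'; rewrite !inE => /andP[_ iS] /andP[_ i'S]; exact: dA.
- by apply: leq_trans Sn; exact: proper_card (properD1 jS).
split; last first.
  move=> w w' ww'; apply: eq_bigr => i iS; apply: (df _ iS) => x xA.
  by apply: ww'; apply/bigcupP; exists i.
rewrite (big_setD1 j) //= -e -(expect_indep (df _ jS) d).
  by apply: eq_expect => w; rewrite (big_setD1 j).
apply/bigcup_disjointP => i; rewrite !inE => /andP[ij iS].
by apply: dA; rewrite // eq_sym.
Qed.

(** * Exponential tail bound and local lemma *)

(** Markov's inequality for [expR (ln (1 + eta) * X)], whose mean is at most [expR (eta * m)] by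
    independence. The threshold has [(1 + eta) ^+ 2] rather than [1 + eta], so that the cheap
    estimate [eta / (1 + eta) <= ln (1 + eta)] already leaves the exponent [eta ^+ 2 * m]. *)
Lemma chernoff_upper_tail (J : finType) (P : pred J) (A : J -> {set I})
    (X : J -> pred Om) (eta m a : R) :
  (forall j, P j -> depends_on (A j) (X j)) ->
  (forall i j, P i -> P j -> i != j -> [disjoint A i & A j]) ->
  0 < eta -> \sum_(j | P j) proba (X j) <= m -> (1 + eta) ^+ 2 * m <= a ->
  proba (fun w => a <= \sum_(j | P j) (X j w)%:R) <= expR (- (eta ^+ 2 * m)).
Proof.
move=> dX dA eta0 Xm ma.
have e1 : 0 < 1 + eta by lra.
have m0 : 0 <= m by apply: le_trans Xm; apply: sumr_ge0 => j _; exact: proba_ge0.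
have lnge : eta / (1 + eta) <= ln (1 + eta).
  have : ln (1 + - (eta / (1 + eta))) <= - (eta / (1 + eta)).
    by apply: le_ln1Dx; rewrite ltrN2 ltr_pdivrMr // mul1r; lra.
  have -> : 1 + - (eta / (1 + eta)) = (1 + eta)^-1 by field; lra.
  by rewrite lnV ?posrE // lerN2.
pose Y w : R := expR (ln (1 + eta) * (\sum_(j | P j) (X j w)%:R)).
have YE w : Y w = \prod_(j | P j) (1 + eta * (X j w)%:R).
  rewrite /Y mulr_sumr expR_sum; apply: eq_bigr => j _.
  case: (X j w); first by rewrite !mulr1 lnK // posrE.
  by rewrite !mulr0 expR0 addr0.
have EY : expect Y <= expR (eta * m).
  rewrite (eq_expect YE) (expect_prod_indep _ dA); last first.
    by move=> j Pj w w' ww'; rewrite (dX j Pj w w' ww').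
  apply: (@le_trans _ _ (\prod_(j | P j) expR (eta * proba (X j)))).
    apply: ler_prod => j _; rewrite expectD expect1 expectZ.
    rewrite addr_ge0 ?mulr_ge0 ?proba_ge0 ?(ltW eta0) //=.
    exact: expR_ge1Dx.
  rewrite -expR_sum ler_expR -mulr_sumr; apply: ler_wpM2l => //; exact: ltW.
apply: (@le_trans _ _ (expect (fun w => expR (- (ln (1 + eta) * a)) * Y w))).
  apply: expect_le => w; case: (boolP (a <= _)) => [aX|_].
    rewrite /Y -expRD -[1%:R]expR0 ler_expR addrC subr_ge0.
    rewrite ler_wpM2l //; apply: le_trans lnge; rewrite divr_ge0 //; exact: ltW.
  by rewrite mulr_ge0 ?expR_ge0.
rewrite expectZ; apply: (@le_trans _ _ (expR (- (ln (1 + eta) * a)) * expR (eta * m))).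
  by rewrite ler_wpM2l ?expR_ge0.
rewrite -expRD ler_expR.
have : eta / (1 + eta) * ((1 + eta) ^+ 2 * m) <= ln (1 + eta) * a.
  apply: ler_pM => //; first by rewrite divr_ge0 // ltW.
  by rewrite mulr_ge0 // exprn_ge0 // ltW.
have -> : eta / (1 + eta) * ((1 + eta) ^+ 2 * m) = eta * m + eta ^+ 2 * m.
  by field; lra.
lra.
Qed.

(** The usual induction: given that any set of events is avoided, [B i] has conditional probability
    at most [2 * proba (B i)]. The nonzero [weight] in the conclusion keeps the outcome inside the
    supports of the coordinate laws. *)
Lemma lovasz_local_lemma (J : finType) (nb : rel J) (D : J -> {set I})
    (B : J -> pred Om) :
  reflexive nb ->
  (forall j, depends_on (D j) (B j)) ->
  (forall i j, ~~ nb i j -> [disjoint D i & D j]) ->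
  (forall i, \sum_(j | nb i j) proba (B j) <= 4^-1) ->
  exists2 w, weight w != 0 & forall j, ~~ B j w.
Proof.
move=> nbR dB nbD nbP.
pose good (S : {set J}) (w : Om) := [forall j in S, ~~ B j w].
have goodD (S : {set J}) : depends_on (\bigcup_(j in S) D j) (good S).
  move=> w w' ww'; apply: eq_forallb_in => j jS; congr negb.
  by apply: dB => i iD; apply: ww'; apply/bigcupP; exists j.
have goodU j (S : {set J}) w : good (j |: S) w = ~~ B j w && good S w.
  apply/forall_inP/andP => [H|[Bj /forall_inP H] i].
    split; first by apply: H; rewrite setU11.
    by apply/forall_inP => i iS; apply: H; rewrite setU1r.
  by rewrite !inE => /orP[/eqP->|/H].
(* Multiplied out to avoid dividing by [proba (good S)], whose positivity is derived afterwards from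
   this very bound. *)
have step (n : nat) : forall (S : {set J}), (#|S| < n)%N -> forall i,
    proba (fun w => B i w && good S w) <= 2 * proba (B i) * proba (good S).
  elim: n => // n IH S; rewrite ltnS => Sn i.
  pose S1 := [set j in S | nb i j]; pose S2 := S :\: S1.
  have indep : proba (fun w => B i w && good S2 w) = proba (B i) * proba (good S2).
    rewrite -(@expect_indep (D i) (\bigcup_(j in S2) D j)).
    - by apply: eq_expect => w; case: (B i w); case: (good S2 w);
        rewrite /= ?(mulr0, mul0r, mulr1).
    - by move=> w w' ww'; rewrite (dB i w w').
    - by move=> w w' ww'; rewrite (goodD S2 w w').
    - apply/bigcup_disjointP => j.
      rewrite !inE => /andP[+ jS]; rewrite jS /= => nij.
      by rewrite nbD.
  have le1 : proba (fun w => B i w && good S w) <= proba (B i) * proba (good S2).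
    rewrite -indep; apply: proba_le => w /andP[-> /forall_inP H] /=.
    by apply/forall_inP => j; rewrite inE => /andP[_ /H].
  have [S10|/set0Pn[j0 j0S1]] := eqVneq S1 finset.set0.
    have S2E : S2 = S by rewrite /S2 S10 finset.setD0.
    rewrite S2E in le1; apply: (le_trans le1).
    rewrite -mulrA mulrDl mul1r lerDl mulr_ge0 ?proba_ge0 //.
  have S2n : (#|S2| < n)%N.
    apply: leq_trans Sn; apply: proper_card.
    apply/properP; split; first exact: subsetDl.
    by exists j0; [move: j0S1; rewrite inE => /andP[] | rewrite inE j0S1].
  (* By induction the neighbours of [i] in [S] together cost at most the fraction [2 * 4^-1] of
     [proba (good S2)]; this is where the constant [4^-1] comes from. *)
  have half : 2^-1 * proba (good S2) <= proba (good S).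
    have sum1 : \sum_(j in S1) proba (fun w => B j w && good S2 w) <=
        2^-1 * proba (good S2).
      apply: (@le_trans _ _ (\sum_(j in S1) 2 * proba (B j) * proba (good S2))).
        by apply: ler_sum => j _; exact: IH.
      rewrite -mulr_suml ler_wpM2r ?proba_ge0 // -mulr_sumr.
      have : \sum_(j in S1) proba (B j) <= 4^-1.
        apply: le_trans (nbP i); rewrite [X in _ <= X](bigID (mem S)) /=.
        rewrite (eq_bigl (fun j => nb i j && (j \in S))); last first.
          by move=> j; rewrite inE andbC.
        by rewrite lerDl sumr_ge0 // => j _; exact: proba_ge0.
      by lra.
    have : proba (good S2) <= proba (good S) +
        \sum_(j in S1) proba (fun w => B j w && good S2 w).
      rewrite -expect_sum -expectD; apply: expect_le => w.
      case: (boolP (good S2 w)) => [g2|_]; last first.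
        by rewrite addr_ge0 // sumr_ge0.
      case: (boolP (good S w)) => [_|]; first by rewrite lerDl sumr_ge0.
      rewrite negb_forall => /existsP[j]; rewrite negb_imply negbK => /andP[jS Bj].
      have jS1 : j \in S1.
        apply: contraT => jS1; move/forall_inP: g2 => /(_ j).
        by rewrite inE jS1 jS Bj => /(_ isT).
      by rewrite add0r (bigD1 j) //= Bj lerDl sumr_ge0.
    by lra.
  apply: (le_trans le1); rewrite (mulrC 2) -mulrA ler_wpM2l ?proba_ge0 //.
  by lra.
(* Avoiding one more event loses at most half of the remaining probability. *)
have pos (S : {set J}) : 0 < proba (good S).
  have [n] := ubnP #|S|; elim: n S => // n IH S; rewrite ltnS => Sn.
  have [->|[j jS]] := set_0Vmem S.
    rewrite (_ : proba _ = 1) // -[RHS]expect1; apply: eq_expect => w.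
    by rewrite (_ : good _ w = true) //; apply/forall_inP => j; rewrite inE.
  have g0 := IH _ (leq_trans (proper_card (properD1 jS)) Sn).
  have : proba (good (S :\ j)) = proba (good S) +
      proba (fun w => B j w && good (S :\ j) w).
    rewrite -expectD; apply: eq_expect => w.
    rewrite -{2}(finset.setD1K jS) goodU.
    by case: (B j w); case: (good _ w); rewrite ?addr0 ?add0r.
  have := step #|S|.+1 (S :\ j) _ j; rewrite ltnS => /(_ (subset_leq_card (subsetDl _ _))).
  have : proba (B j) <= 4^-1.
    apply: le_trans (nbP j); rewrite (bigD1 j) ?nbR //= lerDl.
    by apply: sumr_ge0 => i _; exact: proba_ge0.
  nra.
have := pos [set: J]; rewrite lt_neqAle eq_sym => /andP[+ _].
have [[w w0 /forall_inP gw] _|ng] :=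
  pselect (exists2 w, weight w != 0 & good [set: J] w).
  by exists w => // j; apply: gw.
rewrite /proba /expect big1 ?eqxx // => w _.
have [->|w0] := eqVneq (weight w) 0; first by rewrite mul0r.
by case: (boolP (good _ w)) => [gw|]; [case: ng; exists w | rewrite mulr0].
Qed.

End ProductMeasure.

(** * Neighbourhoods in uncrowded hypergraphs *)


Section UncrowdedHypergraph.
Variables (V : finType) (H : {set {set V}}).
Hypothesis uncrH : uncrowded H.

(** With tuples, distinctness is decided by [uniq] and the incidences by running through the
    indices. The vertex of index [i] lies in the edges of index [i] and [i + 1], cyclically. *)
Lemma no_cycle r (es : r.-tuple {set V}) (vs : r.-tuple V) :
  (2 <= r <= 4)%N -> uniq es -> uniq vs -> all (mem H) es ->
  ~ (forall i, tnth vs i \in tnth es i :&: tnth es (ordS i)).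
Proof.
move=> r24 ues uvs /all_tnthP esH inc; apply: (uncrH r24).
exists (tnth es), (tnth vs); split=> //; exact/tuple_uniqP.
Qed.

Lemma no_2cycle e f x y : e \in H -> f \in H -> e != f ->
  x \in e -> x \in f -> y \in e -> y \in f -> x = y.
Proof.
move=> eH fH ef xe xf ye yf; apply/eqP/negPn/negP => xy.
apply: (@no_cycle 2 [tuple e; f] [tuple x; y]) => //=.
- by rewrite inE ef.
- by rewrite inE xy.
- by rewrite eH fH.
- by case=> [[|[|]]] // i; rewrite !(tnth_nth x) !(tnth_nth e) /= inE ?xe ?xf ?ye ?yf.
Qed.

Lemma no_3cycle e f g x y z : e \in H -> f \in H -> g \in H -> uniq [:: e; f; g] ->
  uniq [:: x; y; z] ->
  x \in e -> x \in f -> y \in f -> y \in g -> z \in g -> z \in e -> False.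
Proof.
move=> eH fH gH u1 u2 xe xf yf yg zg ze.
apply: (@no_cycle 3 [tuple e; f; g] [tuple x; y; z]) => //=.
- by rewrite eH fH gH.
- by case=> [[|[|[|]]]] // i; rewrite !(tnth_nth x) !(tnth_nth e) /= inE
    ?xe ?xf ?yf ?yg ?zg ?ze.
Qed.

Lemma no_4cycle e f g h x y z t : e \in H -> f \in H -> g \in H -> h \in H ->
  uniq [:: e; f; g; h] -> uniq [:: x; y; z; t] ->
  x \in e -> x \in f -> y \in f -> y \in g -> z \in g -> z \in h ->
  t \in h -> t \in e -> False.
Proof.
move=> eH fH gH hH u1 u2 xe xf yf yg zg zh th te.
apply: (@no_cycle 4 [tuple e; f; g; h] [tuple x; y; z; t]) => //=.
- by rewrite eH fH gH hH.
- by case=> [[|[|[|[|]]]]] // i; rewrite !(tnth_nth x) !(tnth_nth e) /= inE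
    ?xe ?xf ?yf ?yg ?zg ?zh ?th ?te.
Qed.

(* Within one edge [e], resp. through two edges [e], [e'] at [v], the sets
   "[w] together with its neighbours along edges other than [e]" do not meet. *)
Lemma second_nbhd_disjoint_edge e f f' w w' x : e \in H -> f \in H -> f' \in H ->
  w \in e -> w' \in e -> w != w' -> f != e -> f' != e -> w \in f -> w' \in f' ->
  x \in f -> x \in f' -> False.
Proof.
move=> eH fH f'H we w'e ww' fe f'e wf w'f' xf xf'.
have nfw' : w' \notin f.
  by apply: contra ww' => w'f; rewrite (no_2cycle eH fH _ we wf w'e w'f) // eq_sym.
have nf'w : w \notin f'.
  by apply: contra ww' => wf'; rewrite (no_2cycle eH f'H _ we wf' w'e w'f') // eq_sym.
have ff' : f != f' by apply: contraNneq nfw' => ->.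
have xw : x != w by apply: contraNneq nf'w => <-.
have xw' : x != w' by apply: contraNneq nfw' => <-.
apply: (@no_3cycle e f f' w x w') => //=.
  by rewrite !inE negb_or eq_sym fe (eq_sym e) f'e ff'.
by rewrite !inE negb_or eq_sym xw ww' xw'.
Qed.

Lemma second_nbhd_disjoint v e e' f f' w w' x : e \in H -> e' \in H -> e != e' ->
  f \in H -> f' \in H -> v \in e -> v \in e' -> w \in e -> w' \in e' ->
  w != v -> w' != v -> f != e -> f' != e' -> w \in f -> w' \in f' ->
  x \in f -> x \in f' -> False.
Proof.
move=> eH e'H ee' fH f'H ve ve' we w'e' wv w'v fe f'e' wf w'f' xf xf'.
have uneq a b (u u' : V) : a \in H -> b \in H -> u \in a -> u \in b -> u' \in a ->
    u' \in b -> u != u' -> a = b.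
  move=> aH bH ua ub u'a u'b; apply: contraNeq => ab.
  by rewrite (no_2cycle aH bH ab ua ub u'a u'b).
have ww' : w != w'.
  by apply: contraNneq ee' => ww'; rewrite (uneq e e' w v) // ww'.
have nfv : v \notin f by apply: contra fe => vf; rewrite (uneq f e v w) // eq_sym.
have nf'v : v \notin f'.
  by apply: contra f'e' => vf'; rewrite (uneq f' e' v w') // eq_sym.
have nwe' : w \notin e' by apply: contra ee' => we'; rewrite (uneq e e' w v).
have nw'e : w' \notin e by apply: contra ee' => w'e; rewrite (uneq e e' w' v).
have fe' : f != e' by apply: contraNneq nwe' => <-.
have f'e : f' != e by apply: contraNneq nw'e => <-.
have xv : x != v by apply: contraNneq nfv => <-.
(* In general [x] closes the 4-cycle [e], [f], [f'], [e'] through [w], [x], [w'], [v]; if [f = f'],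
   or if [x] is [w] or [w'], a triangle is left. *)
have [ff'|ff'] := eqVneq f f'.
  rewrite -{}ff' in f'e' w'f' xf' nf'v f'e *.
  apply: (@no_3cycle e f e' w w' v) => //=.
    by rewrite !inE negb_or eq_sym fe ee' fe'.
  by rewrite !inE negb_or ww' wv w'v.
have [xw|xw] := eqVneq x w.
  rewrite xw in xf'; apply: (@no_3cycle e f' e' w w' v) => //=.
    by rewrite !inE negb_or eq_sym f'e ee' f'e'.
  by rewrite !inE negb_or ww' wv w'v.
have [xw'|xw'] := eqVneq x w'.
  rewrite xw' in xf; apply: (@no_3cycle e f e' w w' v) => //=.
    by rewrite !inE negb_or eq_sym fe ee' fe'.
  by rewrite !inE negb_or ww' wv w'v.
apply: (@no_4cycle e f f' e' w x w' v) => //=.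
  by rewrite !inE !negb_or eq_sym fe (eq_sym e) f'e ee' ff' fe' f'e'.
by rewrite !inE !negb_or eq_sym xw ww' wv xw' xv w'v.
Qed.

(** * Neighbourhoods and their sizes *)

Definition nbhd (v : V) : {set V} := v |: \bigcup_(e in H | v \in e) e.
(** Radius two: whether a neighbour of [v] remains live and keeps a colour is decided by its own
    neighbours, so a bad event at [v] reads coordinates this far out. *)
Definition ball2 (v : V) : {set V} := \bigcup_(u in nbhd v) nbhd u.

Lemma nbhdP v w : reflect (v = w \/ exists2 e, e \in H & (v \in e) && (w \in e))
  (w \in nbhd v).
Proof.
rewrite in_setU1 eq_sym; apply: (iffP orP) => [[/eqP|/bigcupP[e]]|[/eqP|[e eH /andP[ve we]]]].
- by left.
- by move=> /andP[eH ve] we; right; exists e; rewrite ?ve.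
- by left.
- by right; apply/bigcupP; exists e; rewrite ?eH.
Qed.

Lemma nbhd_sym v w : (w \in nbhd v) = (v \in nbhd w).
Proof.
by apply/nbhdP/nbhdP => -[->|[e eH /andP[ve we]]]; by [left | right; exists e; rewrite ?ve ?we].
Qed.

Lemma nbhd_refl v : v \in nbhd v. Proof. exact: setU11. Qed.

Lemma nbhd_edge e v w : e \in H -> v \in e -> w \in e -> w \in nbhd v.
Proof. by move=> eH ve we; apply/nbhdP; right; exists e; rewrite ?ve. Qed.

Lemma nbhd_sub_ball2 v : nbhd v \subset ball2 v.
Proof. exact: finset.bigcup_sup (nbhd_refl v). Qed.

Lemma ball2_sym v w : (w \in ball2 v) = (v \in ball2 w).
Proof.
by apply/bigcupP/bigcupP => -[u uv wu]; exists u; rewrite // nbhd_sym.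
Qed.

Lemma card_bigcup_le (A : {set V}) (F : V -> {set V}) n :
  (forall u, #|F u| <= n)%N -> (#|\bigcup_(u in A) F u| <= #|A| * n)%N.
Proof.
move=> Fn; rewrite -sum_nat_const; apply: leq_trans (leq_sum _ (fun u _ => Fn u)).
elim/big_rec2: _ => [|u m B _ IH]; first by rewrite cards0.
by rewrite (leq_trans (leq_card_setU _ _)) // leq_add2l.
Qed.

Section Bounded.
Variables (k Delta : nat).
Hypotheses (uniH : uniform k H) (degH : (max_degree H <= Delta)%N).

Lemma degree_le v : (#|[set e in H | v \in e]| <= Delta)%N.
Proof. exact: leq_trans (leq_bigmax v) degH. Qed.

Lemma card_nbhd v : (#|nbhd v| <= 1 + Delta * k)%N.
Proof.
rewrite (leq_trans (leq_card_setU _ _)) // cards1 leq_add2l.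
apply: leq_trans (leq_mul (degree_le v) (leqnn k)).
rewrite -sum_nat_const.
rewrite [X in (_ <= X)%N](eq_bigl (fun e => (e \in H) && (v \in e))); last first.
  by move=> e; rewrite inE.
elim/big_rec2: _ => [|e m B /andP[eH _] IH]; first by rewrite cards0.
rewrite (leq_trans (leq_card_setU _ _)) // leq_add //.
by rewrite (uniH eH).
Qed.

Lemma card_ball2 v : (#|ball2 v| <= (1 + Delta * k) ^ 2)%N.
Proof.
apply: leq_trans (card_bigcup_le (nbhd v) card_nbhd) _.
by rewrite expnS expn1 leq_mul2r card_nbhd orbT.
Qed.

(** Such a [w] is reached from [v] by two successive [ball2] steps through a common point. This is
    the size of a dependency neighbourhood in the local lemma. *)
Lemma card_ball2_meet v :
  (#|[set w | ~~ [disjoint ball2 v & ball2 w]]| <= (1 + Delta * k) ^ 4)%N.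
Proof.
apply: (@leq_trans #|\bigcup_(u in ball2 v) ball2 u|).
  apply/subset_leq_card/fintype.subsetP => w; rewrite inE.
  case/pred0Pn => x /= /andP[xv xw]; apply/bigcupP; exists x => //.
  by rewrite ball2_sym.
apply: leq_trans (card_bigcup_le (ball2 v) card_ball2) _.
by rewrite (expnD _ 2 2) leq_mul2r card_ball2 orbT.
Qed.

End Bounded.
End UncrowdedHypergraph.

(** * One round of the nibble *)


Section Nibble.
Variables (R : realType) (V C : finType) (H : {set {set V}}) (K : nat).
Hypotheses (uniH : uniform K.+1 H) (uncrH : uncrowded H).

(** * Partial colourings and the invariant of the process *)

Section Coloring.
Variables (col : V -> option C) (L : V -> {set C}).

Definition live (e : {set V}) (v : V) : {set V} := [set w in e :\ v | col w == None].

(* [e] may still become monochromatic in colour [c] if [v] receives [c]. *)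
Definition alive (e : {set V}) (v : V) (c : C) : bool :=
  [&& e \in H, v \in e & [forall w in e :\ v, (col w == Some c) ||
                                    ((col w == None) && (c \in L w))]].

Definition cdeg (v : V) (c : C) (m : nat) : nat :=
  #|[set e | alive e v c & #|live e v| == m]|.

(** Lists of exactly [l] colours at every vertex give all tries the same probability. [state_block]
    says that giving a live vertex a colour of its list completes no monochromatic edge, so the
    degree bounds can start at [m = 1]. [L0] holds the original lists, to which all colours
    belong. *)
Record state (L0 : V -> {set C}) (l : nat) (b : nat -> R) : Prop := State {
  state_sub : forall v, L v \subset L0 v;
  state_col : forall v c, col v = Some c -> c \in L0 v;
  state_card : forall v, #|L v| = l;
  state_proper : forall e c, e \in H -> exists2 v, v \in e & col v != Some c;
  state_block : forall v c e, col v = None -> c \in L v -> alive e v c ->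
    (0 < #|live e v|)%N;
  state_deg : forall v c m, col v = None -> c \in L v -> (0 < m <= K)%N ->
    (cdeg v c m)%:R <= b m * l%:R ^+ m }.

Lemma aliveP (e : {set V}) v c : alive e v c ->
  [/\ e \in H, v \in e & forall w, w \in e -> w != v ->
     col w = Some c \/ (col w = None /\ c \in L w)].
Proof.
case/and3P => eH ve /forall_inP He; split=> // w we wv.
have := He w; rewrite !inE wv we => /(_ isT) /orP[/eqP|/andP[/eqP]]; by [left|right].
Qed.

Lemma liveP (e : {set V}) (v w : V) : reflect [/\ w \in e, w != v & col w = None] (w \in live e v).
Proof.
rewrite !inE -andbA; apply: (iffP and3P) => [[wv we /eqP ?]|[we wv /eqP ?]] //.
Qed.

Lemma alive_live (e : {set V}) v c w : alive e v c -> w \in live e v -> c \in L w.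
Proof. by case/aliveP => _ _ He /liveP[we wv cw]; case: (He w we wv) => [|[]//]; rewrite cw. Qed.

Lemma card_live (e : {set V}) v c : alive e v c -> (#|live e v| <= K)%N.
Proof.
case/aliveP => eH ve _.
have <- : #|e :\ v| = K by have := cardsD1 v e; rewrite ve (uniH eH) => -[].
apply/subset_leq_card/fintype.subsetP => w /liveP[we wv _]; by rewrite !inE wv.
Qed.

(** * The random experiment of one round *)

Section Round.
Variables (L0 : V -> {set C}) (l : nat) (b : nat -> R) (theta r : R).
Hypothesis st : state L0 l b.
Hypotheses (l_gt0 : (0 < l)%N) (theta_ge0 : 0 <= theta) (theta_le1 : theta <= 1).
Hypothesis b_ge0 : forall m, 0 <= b m.
Hypothesis r_ge : \sum_(1 <= m < K.+1) b m * theta ^+ m <= r.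
Hypothesis r_le1 : r <= 1.

Definition pr_pick : R := theta / l%:R.

Lemma pr_pick_ge0 : 0 <= pr_pick. Proof. by rewrite divr_ge0. Qed.

Lemma pr_pick_le : pr_pick <= l%:R^-1.
Proof. by rewrite /pr_pick ler_pdivrMr ?ltr0n // mulVf ?pnatr_eq0 -?lt0n. Qed.

Lemma pr_pick_le1 : pr_pick <= 1.
Proof. by apply: le_trans pr_pick_le _; rewrite invf_le1 ?ltr0n // ler1n. Qed.

(** Expected number of edges at [v] whose other live vertices all try [c], the tries being
    independent. *)
Definition fire_rate (v : V) (c : C) : R :=
  \sum_(e | alive e v c) pr_pick ^+ #|live e v|.

(* The coins equalise the survival probabilities: a colour survives at a vertex
   with probability about [expR (- r)], whatever its degree. *)
Definition coin_rate (v : V) (c : C) : R := Num.max 0 (r - fire_rate v c).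

(* Coordinate [(v, None)] is the colour tried by [v], if any; coordinate
   [(v, Some c)] is the coin deleting [c] at [v], which does so when not [None]. *)
Definition round_law (i : V * option C) (t : option C) : R :=
  match i.2, t with
  | None, None => 1 - theta
  | None, Some c => if c \in L i.1 then pr_pick else 0
  | Some c, None => 1 - coin_rate i.1 c
  | Some c, Some c' => if c' == c then coin_rate i.1 c else 0
  end.

Lemma fire_rate_ge0 v c : 0 <= fire_rate v c.
Proof. by apply: sumr_ge0 => e _; rewrite exprn_ge0 ?pr_pick_ge0. Qed.

Lemma r_ge0 : 0 <= r.
Proof. by apply: le_trans r_ge; apply: sumr_ge0 => m _; rewrite mulr_ge0 ?exprn_ge0. Qed.

Lemma coin_rate_ge0 v c : 0 <= coin_rate v c.
Proof. by rewrite le_max lexx. Qed.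

Lemma coin_rate_le1 v c : coin_rate v c <= 1.
Proof. by rewrite ge_max ler01 /= lerBlDr (le_trans r_le1) // lerDl fire_rate_ge0. Qed.

Lemma round_law_ge0 i t : 0 <= round_law i t.
Proof.
case: i t => v [c|] [c'|] /=; rewrite /round_law /= ?subr_ge0 ?coin_rate_le1 //;
  by case: ifP; rewrite ?coin_rate_ge0 ?pr_pick_ge0.
Qed.

Lemma sum_option (f : option C -> R) : \sum_t f t = f None + \sum_c f (Some c).
Proof.
rewrite (bigD1 None) //=; congr (_ + _).
rewrite (reindex_omap Some id) /=; last by case.
by apply: eq_bigl => c; rewrite eqxx.
Qed.

Lemma round_law_sum1 i : \sum_t round_law i t = 1.
Proof.
case: i => v [c|]; rewrite sum_option /round_law /=.
  by rewrite -big_mkcond /= big_pred1_eq subrK.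
rewrite -big_mkcond /= sumr_const (state_card st).
by rewrite /pr_pick -[_ *+ l]mulr_natr mulfVK ?subrK // pnatr_eq0 -lt0n.
Qed.

Local Notation Om := {ffun V * option C -> option C}.
Local Notation Pr := (@proba R _ _ round_law).
Let law_ge0 := round_law_ge0.
Let law_sum1 := round_law_sum1.

(** Colours outside the list have weight 0; reading them as no try makes [pickS] hold at every
    sample point. *)
Definition pick (w : Om) (v : V) : option C :=
  if w (v, None) is Some c then (if c \in L v then Some c else None) else None.
(** Tries count whether or not they are kept. Deletion is thereby a function of the tries at the
    other live vertices of the edge alone, at the price of deleting slightly more. *)
Definition fires (w : Om) (e : {set V}) (v : V) (c : C) : bool :=
  alive e v c && [forall x in live e v, pick w x == Some c].
Definition coin (w : Om) (v : V) (c : C) : bool := w (v, Some c) != None.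
Definition blocked (w : Om) (v : V) (c : C) : bool := [exists e, fires w e v c].
Definition keep (w : Om) (v : V) : {set C} :=
  [set c in L v | ~~ blocked w v c & ~~ coin w v c].

Definition picks (A : {set V}) : {set V * option C} := [set (x, None) | x in A].

Lemma picksP A x t : ((x, t) \in picks A) = (t == None) && (x \in A).
Proof.
apply/imsetP/andP => [[y yA [-> ->]] //|[/eqP -> xA]]; by exists x.
Qed.

Lemma picks_disjoint (A B : {set V}) :
  [disjoint A & B] -> [disjoint picks A & picks B].
Proof.
move=> dAB; rewrite disjoint_subset; apply/fintype.subsetP => -[x t].
by rewrite picksP inE picksP => /andP[-> /(disjointFr dAB) ->].
Qed.

Lemma pick_depends v : depends_on (picks [set v]) (pick^~ v).
Proof. by move=> w w' ww'; rewrite /pick ww' // picksP eqxx inE eqxx. Qed.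

Lemma pr_pick_Some v c : c \in L v -> Pr (fun w => pick w v == Some c) = pr_pick.
Proof.
move=> cL; transitivity (Pr (fun w => w (v, None) == Some c)).
  apply: eq_proba => w; rewrite /pick; case: (w _) => // d.
  by case: ifP => // dL; apply/eqP/eqP => // -[dc]; rewrite dc cL in dL.
by rewrite (proba_coord law_sum1 _ (pred1 (Some c))) big_pred1_eq /round_law /= cL.
Qed.

Lemma pr_pick_None v : Pr (fun w => pick w v == None) = 1 - theta.
Proof.
pose B (t : option C) := if t is Some c then c \notin L v else true.
transitivity (Pr (fun w => B (w (v, None)))).
  by apply: eq_proba => w; rewrite /pick /B; case: (w _) => // d; case: ifP.
rewrite (proba_coord law_sum1 _ B) big_mkcond sum_option /round_law /=.
by rewrite big1 ?addr0 // => c _; case: (c \in L v).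
Qed.

Lemma pr_coin v c : Pr (fun w => coin w v c) = coin_rate v c.
Proof.
rewrite /coin (proba_coord law_sum1 _ (fun t => t != None)) big_mkcond sum_option /=.
by rewrite add0r /round_law /= -big_mkcond /= big_pred1_eq.
Qed.

Lemma fires_depends e v c : depends_on (picks (live e v)) (fun w => fires w e v c).
Proof.
move=> w w' ww'; congr andb; apply: eq_forallb_in => x xl; congr (_ == _).
by apply: pick_depends => -[y t]; rewrite picksP inE => /andP[t0 /eqP->];
  apply: ww'; rewrite picksP t0.
Qed.

Lemma pr_fires e v c : alive e v c -> Pr (fun w => fires w e v c) = pr_pick ^+ #|live e v|.
Proof.
move=> al; rewrite -prodr_const.
transitivity (@expect R _ _ round_law (fun w => \prod_(x in live e v) (pick w x == Some c)%:R)).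
  apply: eq_expect => w; rewrite /fires al /=.
  case: (boolP [forall x in _, _]) => [/forall_inP He|].
    by rewrite big1 // => x xl; rewrite He.
  rewrite negb_forall => /existsP[x]; rewrite negb_imply => /andP[xl /negbTE xc].
  by rewrite (bigD1 x) //= xc mul0r.
rewrite (expect_prod_indep law_sum1 (A := fun x => picks [set x])).
- by apply: eq_bigr => x xl; apply: pr_pick_Some; apply: alive_live al xl.
- by move=> x _ w w' ww'; rewrite (pick_depends ww').
- by move=> x y _ _ xy; apply: picks_disjoint; rewrite disjoints1 inE.
Qed.

(** Edges are sorted by their number of live vertices; the class [m = 0] is empty by
    [state_block]. *)
Lemma sum_alive v c (F : nat -> R) : col v = None -> c \in L v ->
  \sum_(e | alive e v c) F #|live e v| = \sum_(1 <= m < K.+1) (cdeg v c m)%:R * F m.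
Proof.
move=> cv cL; rewrite (partition_big (fun e => inord #|live e v| : 'I_K.+1) xpredT) //=.
transitivity (\sum_(m < K.+1) (cdeg v c m)%:R * F m).
  apply: eq_bigr => m _; rewrite /cdeg -sum1_card natr_sum mulr_suml.
  rewrite [RHS](eq_bigl (fun e => alive e v c && (inord #|live e v| == m))).
    by apply: eq_bigr => e /andP[al /eqP <-]; rewrite inordK ?mul1r // ltnS (card_live al).
  move=> e; rewrite inE; case: (boolP (alive e v c)) => //= al.
  by rewrite -val_eqE /= inordK // ltnS (card_live al).
rewrite -(big_mkord xpredT (fun m => (cdeg v c m)%:R * F m)) big_ltn //.
rewrite (_ : cdeg v c 0 = 0%N) ?mul0r ?add0r //.
apply/eqP; rewrite cards_eq0; apply/eqP/setP => e; rewrite !inE.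
apply/negP => /andP[al /eqP e0]; have := state_block st cv cL al.
by rewrite e0.
Qed.

Lemma scale_pick m n : (n <= m)%N -> l%:R ^+ m * pr_pick ^+ (m - n) = theta ^+ (m - n) * l%:R ^+ n.
Proof.
move=> nm; rewrite /pr_pick exprMn exprVn -{1}(subnK nm) exprD.
by field; rewrite expf_neq0 // pnatr_eq0 -lt0n.
Qed.

Lemma fire_rate_le v c : col v = None -> c \in L v -> fire_rate v c <= r.
Proof.
move=> cv cL; apply: le_trans r_ge; rewrite /fire_rate (sum_alive (fun m => pr_pick ^+ m)) //.
rewrite !big_nat; apply: ler_sum => m /andP[m0 mK].
have := scale_pick (leq0n m); rewrite subn0 expr0 mulr1 => <-.
rewrite mulrA ler_wpM2r ?exprn_ge0 ?pr_pick_ge0 //.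
by apply: (state_deg st) => //; rewrite m0.
Qed.

Lemma fires_eq (w w' : Om) f x d :
  (alive f x d -> forall y, y \in live f x -> w (y, None) = w' (y, None)) ->
  fires w f x d = fires w' f x d.
Proof.
move=> ww'; rewrite /fires; case: (boolP (alive _ _ _)) => //= al.
by apply: eq_forallb_in => y yl; rewrite /pick ww'.
Qed.

(* If [x] fails to keep its colour because of the edge [e] itself, then it tried
   the same colour [p] as the vertex [v] of [e] from which edges are counted.
   Fixing [p] in advance makes this event independent of what happens at [v], so
   that the events for different edges at [v] depend on disjoint coordinates. *)
Definition stay (p : option C) (e : {set V}) (w : Om) (x : V) (c : C) : bool :=
  [&& [|| pick w x == None, pick w x == p
        | [exists j : {set V} * C, ((j.2 \in L x) && (j.1 != e)) &&
                        ((pick w x == Some j.2) && fires w j.1 x j.2)]],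
      [forall (f | f != e), ~~ fires w f x c] & ~~ coin w x c].

(** The edge [e] is left out because all its vertices share it; what is read at different vertices
    of [e] then becomes disjoint. The vertex [x] is added for its own try. *)
Definition priv_nbhd (e : {set V}) (x : V) : {set V} :=
  x |: \bigcup_(f in H | (x \in f) && (f != e)) f.
Definition priv (e : {set V}) (x : V) (c : C) : {set V * option C} :=
  (x, Some c) |: picks (priv_nbhd e x).

Lemma privP e x c y t : ((y, t) \in priv e x c) =
  ((y == x) && (t == Some c)) || ((t == None) && (y \in priv_nbhd e x)).
Proof. by rewrite in_setU1 picksP xpair_eqE. Qed.

Lemma priv_pick (w w' : Om) e x c :
  (forall i, i \in priv e x c -> w i = w' i) -> pick w x = pick w' x.
Proof. by move=> ww'; rewrite /pick ww' // privP setU11 orbT. Qed.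

Lemma stay_depends p e x c : depends_on (priv e x c) (fun w => stay p e w x c).
Proof.
move=> w w' ww'; have pE := priv_pick ww'.
have fE f d : f != e -> fires w f x d = fires w' f x d.
  move=> fe; apply: fires_eq => al y /liveP[yf _ _]; apply: ww'.
  rewrite privP eqxx; apply/orP; right; apply/setU1P; right.
  by apply/bigcupP; exists f => //; case/aliveP: al => -> ->; rewrite fe.
rewrite /stay pE; congr [&& [|| _, _ | _], _ & _].
- apply: eq_existsb => -[f d] /=; case: (boolP (f != e)) => [/fE->//|].
  by rewrite andbF.
- by apply: eq_forallb_in => f /fE ->.
- by rewrite /coin ww' // privP !eqxx.
Qed.

Lemma expect_not (A : pred Om) : @expect R _ _ round_law (fun w => (~~ A w)%:R) = 1 - Pr A.
Proof.
rewrite -[1 in RHS](expect1 law_sum1) -expectB; apply: eq_expect => w.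
by case: (A w); rewrite /= ?subrr ?subr0.
Qed.

Lemma fires_disjoint v e f c : alive e v c -> alive f v c -> e != f ->
  [disjoint live e v & live f v].
Proof.
case/aliveP => eH ve _ /aliveP[fH vf _] ef; apply/pred0P => x /=.
apply/negP => /andP[/liveP[xe xv _] /liveP[xf _ _]].
by move: xv; rewrite (no_2cycle uncrH eH fH ef xe xf ve vf) eqxx.
Qed.

(** Different edges at [x] have disjoint live parts, so survival is a product of independent factors
    [1 - p <= expR (- p)]. Fire rate and coin rate add up to at least [r]; leaving out [e] costs at
    most [pr_pick], as [e] has a live vertex besides [x]. *)
Lemma pr_survive e x c : alive e x c -> (0 < #|live e x|)%N ->
  Pr (fun w => (pick w x == None) && ([forall (f | f != e), ~~ fires w f x c] && ~~ coin w x c))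
   <= (1 - theta) * expR (- r + pr_pick).
Proof.
move=> al l0; set S := [pred f | alive f x c & f != e].
pose g (w : Om) : R := \prod_(f | S f) (~~ fires w f x c)%:R.
have gE w : [forall (f | f != e), ~~ fires w f x c]%:R = g w.
  rewrite /g; case: (boolP [forall (f | _), _]) => [/forall_inP He|].
    by rewrite big1 // => f /andP[_ fe]; rewrite He.
  rewrite negb_forall => /existsP[f]; rewrite negb_imply negbK => /andP[fe fc].
  by rewrite (bigD1 f) /= ?fc ?mul0r //; case/andP: fc => ->.
have gD : depends_on (picks (\bigcup_(f | S f) live f x)) g.
  move=> w w' ww'; apply: eq_bigr => f Sf; congr ((~~ _)%:R).
  by apply: fires_eq => _ y yl; apply: ww'; rewrite picksP; apply/bigcupP; exists f.
have coinD : depends_on [set (x, Some c)] (fun w => (~~ coin w x c)%:R : R).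
  by move=> w w' ww'; rewrite /coin ww' // inE.
have gcD : depends_on ((x, Some c) |: picks (\bigcup_(f | S f) live f x))
    (fun w => (~~ coin w x c)%:R * g w).
  move=> w w' ww'; congr (_ * _); first by apply: coinD => i iP; apply: ww'; rewrite inE iP.
  by apply: gD => i iP; apply: ww'; rewrite inE iP orbT.
rewrite /proba (@eq_expect _ _ _ _ _ (fun w => (pick w x == None)%:R * ((~~ coin w x c)%:R * g w))).
  2: by move=> w; rewrite -gE; case: (_ == None); case: (coin w x c);
    case: [forall (f | f != e), ~~ fires w f x c]; rewrite /= ?(mulr0, mul0r, mulr1).
rewrite (expect_indep law_sum1 (A := picks [set x]) _ gcD); last 2 first.
- by move=> w w' ww'; rewrite (pick_depends ww').
- apply/pred0P => -[y t]; rewrite /= picksP in_setU1 xpair_eqE picksP inE.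
  apply/negP => /andP[/andP[/eqP-> /eqP->]] /=; rewrite eqxx /= => /bigcupP[f _].
  by rewrite !inE eqxx.
rewrite -/(Pr _) pr_pick_None ler_wpM2l ?subr_ge0 //.
rewrite (expect_indep law_sum1 coinD gD); last first.
  apply/pred0P => -[y t]; rewrite /= picksP inE xpair_eqE.
  by apply/negP => /andP[/andP[_ /eqP->]].
rewrite expect_not pr_coin.
rewrite (expect_prod_indep law_sum1 (A := fun f => picks (live f x))); last 2 first.
- by move=> f Sf w w' ww'; rewrite (fires_depends _ ww').
- move=> f f' /andP[alf _] /andP[alf' _] ff'; apply: picks_disjoint.
  exact: fires_disjoint alf alf' ff'.
apply: (@le_trans _ _ (expR (- coin_rate x c) * \prod_(f | S f) expR (- pr_pick ^+ #|live f x|))).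
  have pr1 : pr_pick <= 1 := pr_pick_le1.
  apply: ler_pM; rewrite ?subr_ge0 ?coin_rate_le1 //.
  - apply: prodr_ge0 => f /andP[alf _]; rewrite expect_not pr_fires // subr_ge0.
    by rewrite exprn_ile1 ?pr_pick_ge0.
  - by have := expR_ge1Dx (- coin_rate x c).
  apply: ler_prod => f /andP[alf _]; rewrite expect_not pr_fires // subr_ge0.
  rewrite exprn_ile1 ?pr_pick_ge0 //=.
  by have := expR_ge1Dx (- pr_pick ^+ #|live f x|).
rewrite -expR_sum -expRD ler_expR.
have c1 : r - fire_rate x c <= coin_rate x c by rewrite le_max lexx orbT.
have c2 : fire_rate x c = pr_pick ^+ #|live e x| + \sum_(f | S f) pr_pick ^+ #|live f x|.
  by rewrite /fire_rate (bigD1 e).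
have c3 : pr_pick ^+ #|live e x| <= pr_pick.
  by rewrite -{2}[pr_pick]expr1 ler_wiXn2l ?pr_pick_ge0 ?pr_pick_le1.
rewrite sumrN; lra.
Qed.

(** In order: no try and the colour survives; the try is the prescribed [p]; the try fails because
    of some edge. *)
Definition stay_rate : R := (1 - theta) * expR (- r + pr_pick) + (pr_pick + theta * r).

Lemma stay_rate_ge0 : 0 <= stay_rate.
Proof.
by rewrite !addr_ge0 ?mulr_ge0 ?expR_ge0 ?pr_pick_ge0 ?r_ge0 // subr_ge0.
Qed.

Lemma alive_sym e v c x : alive e v c -> col v = None -> c \in L v ->
  x \in live e v -> alive e x c.
Proof.
case/aliveP => eH ve He cv cL /liveP[xe xv _]; rewrite /alive eH xe /=.
apply/forall_inP => y; rewrite !inE => /andP[yx ye].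
have [->|yv] := eqVneq y v; first by rewrite cv cL orbT.
by have [->|[-> ->]] := He y ye yv; rewrite eqxx ?orbT.
Qed.

Lemma live_gt0 e v x : x \in live e v -> col v = None -> v \in e -> (0 < #|live e x|)%N.
Proof.
move=> /liveP[xe xv _] cv ve; apply/card_gt0P; exists v; apply/liveP.
by split; rewrite // eq_sym.
Qed.

Lemma pr_pick_eq x d : Pr (fun w => pick w x == Some d) <= pr_pick.
Proof.
case: (boolP (d \in L x)) => dL; first by rewrite pr_pick_Some.
rewrite (_ : Pr _ = 0) ?pr_pick_ge0 // -[RHS](expect_cst law_sum1 0).
apply: eq_expect => w; rewrite /pick; case: (w _) => // d'.
by case: (boolP (d' \in L x)) => // dL'; case: eqP => // -[dd]; rewrite -dd dL' in dL.
Qed.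

(** Union bound over the tried colour and the edge. The vertex [x] is not among those tested by
    [fires] at [x], so try and conflict are independent, and each of the [l] colours contributes at
    most [pr_pick * r]. *)
Lemma pr_failed x : col x = None ->
  Pr (fun w => [exists j : {set V} * C, (j.2 \in L x) &&
                        ((pick w x == Some j.2) && fires w j.1 x j.2)]) <= theta * r.
Proof.
move=> cx; apply: le_trans (proba_exists law_ge0 _ _) _.
rewrite -(pair_big_dep xpredT (fun _ d => d \in L x)
  (fun f d => Pr (fun w => (pick w x == Some d) && fires w f x d))) /=.
rewrite (exchange_big_dep (mem (L x))) //=.
apply: (@le_trans _ _ (\sum_(d in L x) pr_pick * r)); last first.
  rewrite sumr_const (state_card st) -mulr_natl mulrA mulrCA divff ?mulr1 //.
  by rewrite pnatr_eq0 -lt0n.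
apply: ler_sum => d dL.
apply: (@le_trans _ _ (pr_pick * fire_rate x d)); last first.
  by rewrite ler_wpM2l ?pr_pick_ge0 ?fire_rate_le.
rewrite /fire_rate mulr_sumr [X in _ <= X]big_mkcond /=.
rewrite [X in X <= _](eq_bigl xpredT); last by move=> f; rewrite dL.
apply: ler_sum => f _.
have -> : Pr (fun w => (pick w x == Some d) && fires w f x d) =
    Pr (fun w => pick w x == Some d) * Pr (fun w => fires w f x d).
  rewrite -(expect_indep law_sum1 (A := picks [set x]) (B := picks (live f x))).
  - by apply: eq_expect => w; case: (_ == _); case: fires; rewrite /= ?(mulr0, mul0r, mulr1).
  - by move=> w w' ww'; rewrite (pick_depends ww').
  - by move=> w w' ww'; rewrite (fires_depends _ ww').
  - by apply: picks_disjoint; rewrite disjoints1 !inE eqxx.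
rewrite pr_pick_Some //; case: ifP => [al|nal]; first by rewrite pr_fires.
rewrite (_ : Pr (fun w => fires w f x d) = 0) ?mulr0 // -[RHS](expect_cst law_sum1 0).
by apply: eq_expect => w; rewrite /fires nal.
Qed.

Lemma pr_stay p e v c x : alive e v c -> col v = None -> c \in L v ->
  x \in live e v -> Pr (fun w => stay p e w x c) <= stay_rate.
Proof.
move=> al cv cL xl; have ve : v \in e by case/aliveP: al.
have cx : col x = None by case/liveP: xl.
pose B1 (w : Om) := (pick w x == None) &&
  ([forall (f | f != e), ~~ fires w f x c] && ~~ coin w x c).
pose B2 (w : Om) := if p is Some d then pick w x == Some d else false.
pose B3 (w : Om) := [exists j : {set V} * C, (j.2 \in L x) &&
                        ((pick w x == Some j.2) && fires w j.1 x j.2)].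
apply: (@le_trans _ _ (Pr (fun w => B1 w || (B2 w || B3 w)))).
  apply: (proba_le law_ge0) => w; rewrite /stay => /andP[/or3P[pN|pp|ex] sv].
  - by rewrite /B1 pN sv.
  - case: p pp @B2 => [d|] /= pp; first by rewrite pp !orbT.
    by rewrite /B1 pp sv.
  - case/existsP: ex => j /andP[/andP[jL _] jf]; apply/orP; right; apply/orP; right.
    by apply/existsP; exists j; rewrite jL.
apply: le_trans (probaU law_ge0 _ _) _; apply: lerD.
  exact: pr_survive (alive_sym al cv cL xl) (live_gt0 xl cv ve).
apply: le_trans (probaU law_ge0 _ _) _; apply: lerD; last exact: pr_failed.
rewrite /B2; case: (p) => [d|]; first exact: pr_pick_eq.
by rewrite (_ : Pr _ = 0) ?pr_pick_ge0 // -[RHS](expect_cst law_sum1 0).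
Qed.

(* Necessary for [e] to be alive at [v] with [j] live vertices after the round. *)
Definition hit (p : option C) (v : V) (c : C) (j : nat) (e : {set V}) (w : Om) : bool :=
  alive e v c &&
  [exists J : {set V}, ((J \subset live e v) && (#|J| == j)) &&
    [forall x in live e v, if x \in J then stay p e w x c else pick w x == Some c]].

(** Other edges through [x] and through [y] that met would form a triangle with [e], and a single
    edge through both would meet [e] twice. *)
Lemma priv_disjoint e v c x y : alive e v c -> x \in live e v -> y \in live e v ->
  x != y -> [disjoint priv e x c & priv e y c].
Proof.
case/aliveP => eH ve _ /liveP[xe xv _] /liveP[ye yv _] xy.
apply/pred0P => -[z t]; rewrite /= !privP; apply/negP => /andP[].
case/orP => [/andP[/eqP-> /eqP->]|/andP[/eqP-> zx]]; first by rewrite (negbTE xy).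
rewrite andbF /= => zy; move: zx zy; rewrite /priv_nbhd.
have dis u u' f : u \in e -> u' \in e -> u != u' -> f \in H -> f != e -> u \in f -> u' \notin f.
  move=> ue u'e uu' fH fe uf; apply: contra uu' => u'f.
  by rewrite (no_2cycle uncrH eH fH _ ue uf u'e u'f) // eq_sym.
case/setU1P => [->|/bigcupP[f /and3P[fH xf fe] zf]].
  case/setU1P => [/eqP|/bigcupP[f /and3P[fH yf fe] xf]]; first by rewrite (negbTE xy).
  by move: (dis x y f xe ye xy fH fe xf); rewrite yf.
case/setU1P => [zy|/bigcupP[f' /and3P[f'H yf' f'e] zf']].
  by move: (dis x y f xe ye xy fH fe xf); rewrite -zy zf.
exact: (second_nbhd_disjoint_edge uncrH eH fH f'H xe ye xy fe f'e xf yf' zf zf').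
Qed.

(** Union bound over the set [J]; for a fixed [J] the conditions at different vertices read disjoint
    coordinates, so their probabilities multiply. *)
Lemma pr_hit p v c j e : alive e v c -> col v = None -> c \in L v ->
  Pr (hit p v c j e) <=
  'C(#|live e v|, j)%:R * (stay_rate ^+ j * pr_pick ^+ (#|live e v| - j)).
Proof.
move=> al cv cL; pose S := [set J : {set V} | J \subset live e v & #|J| == j].
pose A (J : {set V}) (w : Om) :=
  [forall x in live e v, if x \in J then stay p e w x c else pick w x == Some c].
apply: (@le_trans _ _ (\sum_(J in S) Pr (A J))).
  apply: le_trans (proba_exists law_ge0 (fun J => J \in S) A); apply: (proba_le law_ge0) => w.
  by case/andP=> _ /existsP[J /andP[JS AJ]]; apply/existsP; exists J; rewrite inE JS /=.
rewrite -cards_draws -/S mulr_natl -sumr_const; apply: ler_sum => J; rewrite inE.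
case/andP => Jl /eqP Jj.
pose g x (w : Om) : R := (if x \in J then stay p e w x c else pick w x == Some c)%:R.
have -> : Pr (A J) = @expect R _ _ round_law (fun w => \prod_(x in live e v) g x w).
  apply: eq_expect => w; case: (boolP (A J w)) => [/forall_inP Aw|].
    by rewrite big1 // => x xl; rewrite /g Aw.
  rewrite negb_forall => /existsP[x]; rewrite negb_imply => /andP[xl /negbTE xc].
  by rewrite (bigD1 x) //= /g xc mul0r.
rewrite (expect_prod_indep law_sum1 (A := fun x => priv e x c)); last 2 first.
- move=> x xl w w' ww'; rewrite /g; case: ifP => _; last by rewrite (priv_pick ww').
  by rewrite (stay_depends p ww').
- by move=> x y xl yl; exact: priv_disjoint al xl yl.
rewrite (bigID (mem J)) /=; apply: ler_pM.
- by apply: prodr_ge0 => x _; apply: (expect_ge0 law_ge0) => w; rewrite ler0n.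
- by apply: prodr_ge0 => x _; apply: (expect_ge0 law_ge0) => w; rewrite ler0n.
- rewrite (eq_bigl (mem J)); last first.
    by move=> x /=; case: (boolP (x \in J)) => [/(fintype.subsetP Jl)->//|]; rewrite andbF.
  rewrite -Jj -prodr_const; apply: ler_prod => x; rewrite inE => xJ; apply/andP; split.
    by apply: (expect_ge0 law_ge0) => w; rewrite ler0n.
  rewrite /g xJ; apply: (pr_stay _ al) => //; exact: (fintype.subsetP Jl).
- rewrite (eq_bigl (mem (live e v :\: J))); last by move=> x; rewrite !inE andbC.
  have -> : (#|live e v| - j)%N = #|live e v :\: J|.
    by rewrite cardsD (finset.setIidPr Jl) Jj.
  rewrite -prodr_const.
  apply: ler_prod => x; rewrite !inE => /andP[xJ _]; apply/andP; split.
    by apply: (expect_ge0 law_ge0) => w; rewrite ler0n.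
  by rewrite /g (negbTE xJ); exact: pr_pick_eq.
Qed.

Definition hit_supp (v : V) (c : C) (e : {set V}) : {set V * option C} :=
  \bigcup_(x in live e v) priv e x c.

Lemma hit_depends p v c j e : depends_on (hit_supp v c e) (hit p v c j e).
Proof.
move=> w w' ww'; congr andb; apply: eq_existsb => J; congr andb.
apply: eq_forallb_in => x xl.
have ww'x i : i \in priv e x c -> w i = w' i.
  by move=> ip; apply: ww'; apply/bigcupP; exists x.
by rewrite (stay_depends p ww'x) (priv_pick ww'x).
Qed.

(** A shared coordinate would close a cycle through [v] made of [e], [e'] and at most two further
    edges. The absence of cycles of all three lengths 2, 3 and 4 enters here. *)
Lemma hit_supp_disjoint v c e e' : alive e v c -> alive e' v c -> e != e' ->
  [disjoint hit_supp v c e & hit_supp v c e'].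
Proof.
case/aliveP => eH ve _ /aliveP[e'H ve' _] ee'.
apply/pred0P => -[z t]; rewrite /=; apply/negP => /andP[].
case/bigcupP => x /liveP[xe xv _] + /bigcupP[y /liveP[ye' yv _]].
have xy : x != y.
  by apply: contra xv => /eqP xy; rewrite (no_2cycle uncrH eH e'H ee' xe _ ve ve') // xy.
have xe' : x \notin e'.
  by apply: contra xv => xe'; rewrite (no_2cycle uncrH eH e'H ee' xe xe' ve ve').
have ye : y \notin e.
  by apply: contra yv => ye; rewrite (no_2cycle uncrH eH e'H ee' ye ye' ve ve').
rewrite !privP => /orP[/andP[/eqP-> /eqP->]|/andP[/eqP-> zx]].
  by rewrite (negbTE xy).
rewrite andbF /= => zy; move: zx zy; rewrite /priv_nbhd.
have tri f u u' : f \in H -> f != e -> f != e' -> u \in e -> u' \in e' -> u != v ->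
    u' != v -> u != u' -> u \in f -> u' \in f -> False.
  move=> fH fe fe' ue u'e' uv u'v uu' uf u'f.
  apply: (no_3cycle uncrH eH fH e'H _ _ ue uf u'f u'e' ve' ve) => /=.
    by rewrite !inE negb_or eq_sym fe ee' fe'.
  by rewrite !inE negb_or uu' uv u'v.
have ne (f : {set V}) u : u \in f -> u \notin e -> f != e by move=> uf; apply: contraNneq => <-.
have ne' (f : {set V}) u : u \in f -> u \notin e' -> f != e' by move=> uf; apply: contraNneq => <-.
case/setU1P => [->|/bigcupP[f /and3P[fH xf fe] zf]].
  case/setU1P => [/eqP|/bigcupP[f /and3P[fH yf fe'] xf]]; first by rewrite (negbTE xy).
  exact: (tri f x y fH (ne _ _ yf ye) fe' xe ye' xv yv xy xf yf).
case/setU1P => [zy|/bigcupP[f' /and3P[f'H yf' f'e'] zf']].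
  by rewrite zy in zf; exact: (tri f x y fH fe (ne' _ _ xf xe') xe ye' xv yv xy xf zf).
exact: (second_nbhd_disjoint uncrH eH e'H ee' fH f'H ve ve' xe ye' xv yv fe f'e' xf yf' zf zf').
Qed.

Lemma pr_many_hits p v c j (eta mu a : R) : col v = None -> c \in L v -> 0 < eta ->
  \sum_(1 <= m < K.+1) b m * 'C(m, j)%:R * stay_rate ^+ j * theta ^+ (m - j) * l%:R ^+ j
    <= mu -> (1 + eta) ^+ 2 * mu <= a ->
  Pr (fun w => a <= \sum_(e | alive e v c) (hit p v c j e w)%:R) <= expR (- (eta ^+ 2 * mu)).
Proof.
move=> cv cL eta0 muP ma.
apply: (chernoff_upper_tail law_ge0 law_sum1 (A := hit_supp v c)) => //.
- by move=> e _; exact: hit_depends.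
- by move=> e e'; exact: hit_supp_disjoint.
apply: le_trans muP.
pose F m := 'C(m, j)%:R * (stay_rate ^+ j * pr_pick ^+ (m - j)).
apply: (@le_trans _ _ (\sum_(e | alive e v c) F #|live e v|)).
  by apply: ler_sum => e al; exact: pr_hit.
rewrite (sum_alive F) // !big_nat; apply: ler_sum => m /andP[m0 mK].
have F0 : 0 <= F m by rewrite /F !mulr_ge0 ?exprn_ge0 ?stay_rate_ge0 ?pr_pick_ge0.
have d := state_deg st cv cL (_ : (0 < m <= K)%N).
apply: (@le_trans _ _ (b m * l%:R ^+ m * F m)).
  by apply: ler_wpM2r => //; apply: d; rewrite m0.
rewrite /F; case: (ltnP m j) => [mj|jm]; first by rewrite bin_small // !(mul0r, mulr0).
have -> : b m * l%:R ^+ m * ('C(m, j)%:R * (stay_rate ^+ j * pr_pick ^+ (m - j))) =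
  b m * 'C(m, j)%:R * stay_rate ^+ j * (l%:R ^+ m * pr_pick ^+ (m - j)) by ring.
by rewrite scale_pick // !mulrA.
Qed.

(** * Loss of colours and bad events *)

Lemma fires_inj w e v c d : col v = None -> c \in L v -> fires w e v c ->
  fires w e v d -> c = d.
Proof.
move=> cv cL /andP[al /forall_inP wc] /andP[_ /forall_inP wd].
have /card_gt0P[x xl] := state_block st cv cL al.
by have := wc x xl; rewrite (eqP (wd x xl)) => /eqP[].
Qed.

(** By [fires_inj] an edge deletes at most one colour at [v]. Counting edges, instead of pairs of an
    edge and a colour, gives independent indicators, as the tail bound requires. *)
Lemma card_lost w v : col v = None ->
  (#|L v| - #|keep w v| <= \sum_(e in H) [exists c, (c \in L v) && fires w e v c] +
     \sum_(c in L v) coin w v c)%N.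
Proof.
move=> cv.
have kL : keep w v \subset L v by apply/fintype.subsetP => c; rewrite inE => /andP[].
rewrite -(finset.setIidPr kL) -cardsD.
pose F e := [set c in L v | fires w e v c].
have sub : L v :\: keep w v \subset (\bigcup_(e in H) F e) :|: [set c in L v | coin w v c].
  apply/fintype.subsetP => c; rewrite !inE => /andP[+ cL].
  rewrite cL /= -negb_or negbK => /orP[/existsP[e fe]|->]; last by rewrite orbT.
  apply/orP; left; apply/bigcupP; exists e; last by rewrite inE cL.
  by case/andP: fe => /aliveP[].
apply: leq_trans (subset_leq_card sub) _; apply: leq_trans (leq_card_setU _ _) _.
apply: leq_add; last first.
  rewrite -sum1_card big_mkcond [X in (_ <= X)%N]big_mkcond /=; apply: leq_sum => c _.
  by rewrite inE; case: (c \in L v); case: coin.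
apply: (@leq_trans (\sum_(e in H) #|F e|)).
  elim/big_rec2: _ => [|e m B _ IH]; first by rewrite cards0.
  by rewrite (leq_trans (leq_card_setU _ _)) // leq_add2l.
apply: leq_sum => e _; case: existsP => [[c /andP[cL fc]]|nF]; last first.
  rewrite leqn0 cards_eq0; apply/eqP/setP => c; rewrite !inE; apply/negP => cF.
  by apply: nF; exists c.
apply: (@leq_trans #|[set c]|); last by rewrite cards1.
apply/subset_leq_card/fintype.subsetP => d.
by rewrite !inE => /andP[dL fd]; rewrite (fires_inj cv cL fc fd).
Qed.

(** Edges and coins are indexed by one sum type, to form a single family of independent indicators.
    For each colour the fire rate and the coin rate add up to [r], whence the bound [r * l%:R] on
    the mean. *)
Lemma pr_many_lost v (eta a : R) : col v = None -> 0 < eta ->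
  (1 + eta) ^+ 2 * (r * l%:R) <= a ->
  Pr (fun w => a <= (#|L v| - #|keep w v|)%:R) <= expR (- (eta ^+ 2 * (r * l%:R))).
Proof.
move=> cv eta0 ma.
pose P (i : {set V} + C) := match i with inl e => (e \in H) && (v \in e) | inr c => c \in L v end.
pose X (i : {set V} + C) (w : Om) := match i with
  | inl e => [exists c, (c \in L v) && fires w e v c] | inr c => coin w v c end.
pose A (i : {set V} + C) : {set V * option C} := match i with
  | inl e => picks (live e v) | inr c => [set (v, Some c)] end.
have sumP (F : {set V} + C -> R) :
    \sum_(i | P i) F i = \sum_(e in H | v \in e) F (inl e) + \sum_(c in L v) F (inr c).
  by rewrite big_sumType.
apply: (@le_trans _ _ (Pr (fun w => a <= \sum_(i | P i) (X i w)%:R))).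
  apply: (proba_le law_ge0) => w /le_trans; apply.
  rewrite sumP; apply: (@le_trans _ _ (\sum_(e in H) [exists c, (c \in L v) && fires w e v c]
      + \sum_(c in L v) coin w v c)%N%:R); first by rewrite ler_nat card_lost.
  rewrite natrD !natr_sum lerD2r [X in X <= _](bigID (fun e : {set V} => v \in e)) /=.
  rewrite [X in _ + X]big1 ?addr0 // => e /andP[_ ve].
  case: existsP => // -[c /andP[_ /andP[/aliveP[_ ve']]]].
  by rewrite ve' in ve.
apply: (chernoff_upper_tail law_ge0 law_sum1 (A := A)) => //.
- case=> [e|c] _ w w' ww' /=; last by rewrite /coin ww' // /A inE.
  by apply: eq_existsb => c; congr andb; apply: fires_depends.
- move=> [e|c] [f|d] /= Pi Pj ij.
  + apply: picks_disjoint; apply/pred0P => x /=; apply/negP => /andP[/liveP[xe xv _]].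
    case/liveP => xf _ _; case/andP: Pi => eH ve; case/andP: Pj => fH vf.
    have ef : e != f by apply: contra ij => /eqP->.
    by move: xv; rewrite (no_2cycle uncrH eH fH ef xe xf ve vf) eqxx.
  + by rewrite disjoint_sym disjoints1 picksP.
  + by rewrite disjoints1 picksP.
  + by rewrite disjoints1 inE xpair_eqE eqxx /=; apply: contra ij => /eqP[->].
rewrite sumP.
have -> : r * l%:R = \sum_(c in L v) fire_rate v c + \sum_(c in L v) (r - fire_rate v c).
  by rewrite -big_split /= (eq_bigr (fun=> r)) => [|c _];
    rewrite ?sumr_const ?(state_card st) ?mulr_natr // addrC subrK.
apply: lerD; last first.
  apply: ler_sum => c cL; rewrite pr_coin /coin_rate max_r //.
  by rewrite subr_ge0 fire_rate_le.
apply: (@le_trans _ _ (\sum_(e in H | v \in e) \sum_(c in L v) Pr (fun w => fires w e v c))).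
  by apply: ler_sum => e _; exact: (proba_exists law_ge0).
rewrite exchange_big /=; apply: ler_sum => c cL.
rewrite /fire_rate big_mkcond [X in _ <= X]big_mkcond; apply: ler_sum => e _.
case: (boolP (alive e v c)) => [al|/negbTE nal].
  by rewrite pr_fires //; case: ifP => // _; rewrite exprn_ge0 ?pr_pick_ge0.
rewrite (_ : Pr _ = 0) ?if_same // -[RHS](expect_cst law_sum1 0).
by apply: eq_expect => w; rewrite /fires nal.
Qed.

(** The last component of [q] runs over all possible tries of [v], so that [hit] is always used with
    [p] fixed; the actual try is substituted only once a good outcome is at hand. *)
Definition bad (a0 : R) (a : nat -> R) (v : V) (w : Om) : bool :=
  (col v == None) &&
  ((a0 <= (#|L v| - #|keep w v|)%:R) ||
   [exists q : C * 'I_K.+1 * option C,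
     [&& q.1.1 \in L v, (0 < q.1.2)%N & q.2 \in None |: [set Some d | d in L v]] &&
     (a q.1.2 <= \sum_(e | alive e v q.1.1) (hit q.2 v q.1.1 q.1.2 e w)%:R)]).

Lemma bad_depends a0 a v :
  depends_on [set i : V * option C | i.1 \in ball2 H v] (bad a0 a v).
Proof.
move=> w w' ww'.
have inN e x : e \in H -> v \in e -> x \in e -> x \in nbhd H v by exact: nbhd_edge.
have in2 x : x \in nbhd H v -> x \in ball2 H v.
  by apply/fintype.subsetP; exact: nbhd_sub_ball2.
congr (_ && (_ || _)).
  suff -> : keep w v = keep w' v by [].
  apply/setP => c; rewrite !inE; congr [&& _, ~~ _ & ~~ _].
    apply: eq_existsb => e; apply: fires_eq => /aliveP[eH ve _] y /liveP[ye _ _].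
    by apply: ww'; rewrite inE /= in2 // (inN e).
  by rewrite /coin ww' // inE /= in2 // nbhd_refl.
apply: eq_existsb => -[[c j] p] /=; congr andb; congr (_ <= _).
apply: eq_bigr => e al; rewrite (@hit_depends p v c j e w w') //.
case/aliveP: al => eH ve _ -[y t] /bigcupP[x /liveP[xe _ _]].
rewrite privP => yx; apply: ww'; rewrite inE /=; apply/bigcupP; exists x.
  exact: inN eH ve xe.
case/orP: yx => [/andP[/eqP-> _]|/andP[_ /setU1P[->|/bigcupP[f /and3P[fH xf _] yf]]]].
- exact: nbhd_refl.
- exact: nbhd_refl.
- exact: nbhd_edge fH xf yf.
Qed.

Lemma pr_bad (eta A : R) (mu a : nat -> R) v : 0 < eta ->
  (forall j, (0 < j <= K)%N ->
    \sum_(1 <= m < K.+1) b m * 'C(m, j)%:R * stay_rate ^+ j * theta ^+ (m - j) * l%:R ^+ j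
    <= mu j /\ (1 + eta) ^+ 2 * mu j <= a j) ->
  A <= eta ^+ 2 * (r * l%:R) -> (forall j, (0 < j <= K)%N -> A <= eta ^+ 2 * mu j) ->
  Pr (bad ((1 + eta) ^+ 2 * (r * l%:R)) a v) <= (1 + l * K.+1 * l.+1)%:R * expR (- A).
Proof.
move=> eta0 mua A0 Aj.
case: (eqVneq (col v) None) => [cv|ncv]; last first.
  rewrite (_ : Pr _ = 0) ?mulr_ge0 ?expR_ge0 // -[RHS](expect_cst law_sum1 0).
  by apply: eq_expect => w; rewrite /bad (negbTE ncv).
set Q : pred (C * 'I_K.+1 * option C) := fun q =>
  [&& q.1.1 \in L v, (0 < q.1.2)%N & q.2 \in None |: [set Some d | d in L v]].
set B := fun (q : C * 'I_K.+1 * option C) (w : Om) =>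
  a q.1.2 <= \sum_(e | alive e v q.1.1) (hit q.2 v q.1.1 q.1.2 e w)%:R.
apply: (@le_trans _ _ (Pr (fun w => ((1 + eta) ^+ 2 * (r * l%:R) <= (#|L v| - #|keep w v|)%:R)
    || [exists q, Q q && B q w]))).
  by apply: (proba_le law_ge0) => w /andP[].
apply: le_trans (probaU law_ge0 _ _) _.
rewrite natrD mulrDl mul1r; apply: lerD.
  apply: le_trans (pr_many_lost cv eta0 (lexx _)) _.
  by rewrite ler_expR lerN2.
apply: le_trans (proba_exists law_ge0 Q B) _.
apply: (@le_trans _ _ (\sum_(q | Q q) expR (- A))).
  apply: ler_sum => -[[c j] p] /and3P[/= cL j0 _].
  have jK : (0 < j <= K)%N by rewrite j0 -ltnS ltn_ord.
  have [m1 m2] := mua j jK.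
  apply: le_trans (pr_many_hits p cv cL eta0 m1 m2) _.
  by rewrite ler_expR lerN2 Aj.
(* At most [l] colours, [K + 1] values of [j] and [l + 1] values of the try. *)
rewrite sumr_const -[X in X <= _]mulr_natl ler_wpM2r ?expR_ge0 // ler_nat.
pose S := finset.setX (finset.setX (L v) [set: 'I_K.+1]) (None |: [set Some d | d in L v]).
apply: (@leq_trans #|S|).
  apply/subset_leq_card/fintype.subsetP => -[[c j] p] /and3P[/= cL _ pS].
  by rewrite !finset.in_setX /= cL pS inE.
rewrite !cardsX cardsT card_ord (state_card st) leq_mul2l; apply/orP; right.
rewrite (leq_trans (leq_card_setU _ _)) // cards1 add1n ltnS.
by apply: leq_trans (leq_imset_card _ _) _; rewrite (state_card st).
Qed.

Definition new_col (w : Om) (v : V) : option C :=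
  if col v is Some c then Some c else
  if pick w v is Some c then (if blocked w v c then None else Some c) else None.

Lemma new_colN w v : new_col w v = None ->
  col v = None /\ (pick w v = None \/ exists2 d, pick w v = Some d & blocked w v d).
Proof.
rewrite /new_col; case: (col v) => // ; case: (pick w v) => [d|] //; last by split=> //; left.
by case: ifP => // bd _; split=> //; right; exists d.
Qed.

Lemma new_colS w v c : new_col w v = Some c ->
  col v = Some c \/ [/\ col v = None, pick w v = Some c & ~~ blocked w v c].
Proof.
rewrite /new_col; case: (col v) => [d|]; first by move=> ->; left.
by case: (pick w v) => [d|] //; case: ifP => // /negbT bd [<-]; right.
Qed.

Lemma pickS w v c : pick w v = Some c -> c \in L v.
Proof. by rewrite /pick; case: (w _) => // d; case: ifP => // dL [<-]. Qed.

End Round.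
End Coloring.

(** * The state after a round *)

Section NextState.
Variables (col : V -> option C) (L L0 : V -> {set C}) (l : nat) (b : nat -> R).
Hypothesis st : state col L L0 l b.
Variables (w : {ffun V * option C -> option C}) (L' : V -> {set C}) (l' : nat)
  (b' : nat -> R).
Hypotheses (L'L : forall v, L' v \subset L v)
  (L'keep : forall v, col v = None -> L' v \subset keep col L w v)
  (L'card : forall v, #|L' v| = l').
Hypothesis hits : forall v c j, col v = None -> c \in L v -> (0 < j <= K)%N ->
  \sum_(e | alive col L e v c) (hit col L (pick L w v) v c j e w)%:R <= b' j * l'%:R ^+ j :> R.

Local Notation col' := (new_col col L w).

Lemma keepP v c : col v = None -> c \in L' v -> ~~ blocked col L w v c /\ ~~ coin w v c.
Proof. by move=> cv /(fintype.subsetP (L'keep cv)); rewrite inE => /and3P[]. Qed.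

Lemma alive_prev e v c : alive col' L' e v c -> alive col L e v c.
Proof.
case/aliveP => eH ve He; rewrite /alive eH ve; apply/forall_inP => x.
rewrite !inE => /andP[xv xe]; case: (He x xe xv) => [|[/new_colN[-> _] cx]].
  by case/new_colS=> [->|[-> /pickS -> _]]; rewrite eqxx ?orbT.
by rewrite (fintype.subsetP (L'L x)) // orbT.
Qed.

Lemma alive_fires e v c : alive col' L' e v c ->
  (forall x, x \in live col e v -> col' x = Some c) -> fires col L w e v c.
Proof.
move=> al all_c; rewrite /fires (alive_prev al); apply/forall_inP => x xl.
have cx : col x = None by case/liveP: xl.
by case/new_colS: (all_c x xl) => [|[_ -> _]]; rewrite ?cx.
Qed.

(** A vertex [x] of [e] that remains live made no try, or its try was blocked by another edge, or by
    [e] itself. In the last case [v] is one of the live vertices tested, hence tried the same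
    colour; this is why [p] is the try of [v]. *)
Lemma alive_hit e v c : alive col' L' e v c -> col' v = None -> c \in L' v ->
  hit col L (pick L w v) v c #|live col' e v| e w.
Proof.
move=> al cv' cL'; have al0 := alive_prev al; rewrite /hit al0 /=.
have [cv _] := new_colN cv'; have cL := fintype.subsetP (L'L v) _ cL'.
apply/existsP; exists (live col' e v); rewrite eqxx andbT; apply/andP; split.
  by apply/fintype.subsetP => x /liveP[xe xv /new_colN[cx _]]; apply/liveP.
apply/forall_inP => x xl; have [xe xv cx] := liveP _ _ _ _ xl.
have [_ _ He] := aliveP al; case: ifP => [/liveP[_ _ cx']|nxl]; last first.
  case: (He x xe xv) => [/new_colS[|[_ -> _]] //|[cx' _]]; first by rewrite cx.
  by move/negP: nxl; case; apply/liveP.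
have cL'x : c \in L' x by case: (He x xe xv) => [|[]//]; rewrite cx'.
have [nb nc] := keepP cx cL'x; rewrite /stay nc andbT; apply/andP; split; last first.
  apply/forall_inP => f _; apply: contra nb => fx.
  by apply/existsP; exists f.
have [_ [->//|[d pd /existsP[f ff]]]] := new_colN cx'.
have [fe|fe] := eqVneq f e; last first.
  apply/or3P/Or33; apply/existsP; exists (f, d); rewrite /= pd (pickS pd) fe eqxx /=.
  by [].
apply/or3P/Or32; rewrite pd eq_sym; rewrite fe in ff.
case/andP: ff => _ /forall_inP; apply; apply/liveP; split=> //; last by rewrite eq_sym.
by case/aliveP: al.
Qed.

Lemma next_state : state col' L' L0 l' b'.
Proof.
split=> //.
- by move=> v; apply: fintype.subset_trans (L'L v) (state_sub st v).
- move=> v c /new_colS[|[_ /pickS cL _]]; first exact: state_col st _ _.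
  by apply: (fintype.subsetP (state_sub st v)).
(* An edge turned monochromatic contains a newly coloured vertex [v]; it would fire at [v] and block
   the try made there. *)
- move=> e c eH; apply/exists_inP; apply: contraT => /exists_inPn all_c; exfalso.
  have {}all_c v : v \in e -> col' v = Some c by move=> /all_c/negPn/eqP.
  have [v ve cv] := state_proper st c eH.
  case/new_colS: (all_c v ve) => [|[cvN _ /negP]]; first by move/eqP: cv.
  apply; apply/existsP; exists e; apply: alive_fires.
    rewrite /alive eH ve; apply/forall_inP => x; rewrite !inE => /andP[_ xe].
    by rewrite all_c ?eqxx.
  by move=> x /liveP[xe _ _]; exact: all_c.
(* An alive edge left without live vertices fired for [c] at [v], so [c] was deleted from the
   list. *)
- move=> v c e cv' cL' al; rewrite lt0n cards_eq0; apply/negP => /eqP l0.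
  have [cv _] := new_colN cv'; have [/negP nb _] := keepP cv cL'.
  apply: nb; apply/existsP; exists e; apply: alive_fires => // x /liveP[xe xv cx].
  case/aliveP: al => _ _ /(_ x xe xv) [//|[cx' _]].
  have : x \in live col' e v by apply/liveP.
  by rewrite l0 inE.
- move=> v c m cv' cL' mK; have [cv _] := new_colN cv'.
  have cL := fintype.subsetP (L'L v) _ cL'.
  apply: le_trans (hits cv cL mK); rewrite -natr_sum ler_nat /cdeg -sum1_card.
  rewrite big_mkcond [X in (_ <= X)%N]big_mkcond /=; apply: leq_sum => e _.
  rewrite inE; case: (boolP (alive col' L' e v c)) => //= al.
  rewrite (alive_prev al); case: eqP => // <-.
  by rewrite (alive_hit al).
Qed.

End NextState.

Lemma subset_card_eq (T : finType) (A : {set T}) n : (n <= #|A|)%N ->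
  exists2 B : {set T}, B \subset A & #|B| = n.
Proof.
move=> nA; have [|[B]] := set_0Vmem [set B : {set T} | B \subset A & #|B| == n].
  move/eqP; rewrite -cards_eq0 cards_draws => /eqP.
  by move: nA; rewrite -bin_gt0 => /[swap] ->.
by rewrite inE => /andP[BA /eqP]; exists B.
Qed.

(** The local lemma is applied to one event [bad] per vertex, with dependency through intersecting
    [ball2]; the last hypothesis is its condition. Lists are then cut down to the common size
    [l']. *)
Lemma nibble_round (col : V -> option C) (L L0 : V -> {set C}) (Delta l l' : nat)
    (b b' mu : nat -> R) (theta r eta A : R) :
  (max_degree H <= Delta)%N -> state col L L0 l b ->
  (0 < l)%N -> (l' <= l)%N -> 0 <= theta <= 1 -> (forall m, 0 <= b m) ->
  \sum_(1 <= m < K.+1) b m * theta ^+ m <= r -> r <= 1 -> 0 < eta ->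
  l'%:R < l%:R - (1 + eta) ^+ 2 * (r * l%:R) + 1 ->
  (forall j, (0 < j <= K)%N ->
    \sum_(1 <= m < K.+1) b m * 'C(m, j)%:R * stay_rate l theta r ^+ j *
      theta ^+ (m - j) * l%:R ^+ j <= mu j /\ (1 + eta) ^+ 2 * mu j <= b' j * l'%:R ^+ j) ->
  A <= eta ^+ 2 * (r * l%:R) -> (forall j, (0 < j <= K)%N -> A <= eta ^+ 2 * mu j) ->
  ((1 + Delta * K.+1) ^ 4 * (1 + l * K.+1 * l.+1))%:R * expR (- A) <= 4^-1 ->
  exists col' L', state col' L' L0 l' b'.
Proof.
move=> degH st l0 l'l /andP[th0 th1] b0 rb r1 eta0 l'P mua A0 Aj PA.
pose a j := b' j * l'%:R ^+ j.
pose B := bad col L ((1 + eta) ^+ 2 * (r * l%:R)) a.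
have [||v|v|u v|v|w _ wB] := @lovasz_local_lemma R _ _ (round_law col L l theta r)
    _ _ V (fun u v => ~~ [disjoint ball2 H u & ball2 H v])
    (fun v => [set i | i.1 \in ball2 H v]) B.
- exact: round_law_ge0.
- exact: round_law_sum1 st l0.
- apply/pred0Pn; exists v; rewrite /= andbb.
  exact: (fintype.subsetP (nbhd_sub_ball2 H v)) (nbhd_refl H v).
- exact: bad_depends.
- rewrite negbK => duv; apply/pred0P => -[x t] /=; rewrite !inE /=.
  by apply/negP => /andP[/(disjointFr duv) ->].
- apply: le_trans PA; rewrite natrM -mulrA.
  apply: (@le_trans _ _ (\sum_(u | ~~ [disjoint ball2 H v & ball2 H u])
     (1 + l * K.+1 * l.+1)%:R * expR (- A))).
    by apply: ler_sum => u _; apply: (pr_bad st l0 th0 th1 b0 rb r1 u eta0 mua A0 Aj).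
  rewrite sumr_const -[X in X <= _]mulr_natl ler_wpM2r ?mulr_ge0 ?expR_ge0 // ler_nat.
  have := card_ball2_meet uniH degH v; rewrite cardsE; exact: leq_trans.
have kept v : exists2 A : {set C}, (A \subset L v) && ((col v == None) ==> (A \subset keep col L w v))
     & #|A| = l'.
  case: (eqVneq (col v) None) => [cv|ncv]; last first.
    have [|A' AL Al] := @subset_card_eq _ (L v) l'; first by rewrite (state_card st).
    by exists A'; rewrite ?AL.
  have kL : keep col L w v \subset L v by apply/fintype.subsetP => c; rewrite inE => /andP[].
  have kl : (l' <= #|keep col L w v|)%N.
    (* The kept list has more than [l' - 1] colours, hence at least [l']; this integrality is the
       [+ 1] in the hypothesis on [l']. *)
    have := wB v; rewrite /B /bad cv eqxx /= negb_or -ltNge => /andP[+ _].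
    rewrite natrB ?subset_leq_card // (state_card st) => lost.
    rewrite -ltnS -(ltr_nat R) -natr1; lra.
  have [A' AL Al] := subset_card_eq kl; exists A' => //=.
  by rewrite AL (fintype.subset_trans AL kL).
have {}kept v : exists A : {set C}, [/\ A \subset L v,
    col v = None -> A \subset keep col L w v & #|A| = l'].
  have [A' /andP[AL Ak] Al] := kept v; exists A'; split=> // cv.
  by move: Ak; rewrite cv.
have [L' L'P] := choice kept; exists (new_col col L w), L'.
apply: (next_state st); first by move=> v; have [] := L'P v.
- by move=> v; have [] := L'P v.
- by move=> v; have [] := L'P v.
- move=> v c j cv cL /andP[j0 jK]; rewrite leNgt; apply/negP => lt.
  have := wB v; rewrite /B /bad cv eqxx /= negb_or => /andP[_ /existsPn].
  (* Here [p] becomes the actual try of [v], which is [None] or a colour of its list and so among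
     the values covered by [bad]. *)
  move/(_ (c, inord j, pick L w v)); rewrite /= inordK // cL j0 /= => /negP; apply.
  apply/andP; split; last exact: ltW.
  case: (pick L w v) (@pickS L w v) => [d|] pS; rewrite in_setU1 //=.
  by apply/imsetP; exists d; rewrite ?pS.
Qed.

(** * Colouring the remaining vertices *)

(** Every vertex draws a uniform colour of its list. A colour together with an alive edge having [m]
    further live vertices contributes [l^-(m+1)]; the [l] colours at a vertex, each with at most
    [b m * l^m] such edges, give [b m]. An edge meets other events through at most [K + 1] live
    vertices. *)
Lemma finish_coloring (col : V -> option C) (L L0 : V -> {set C}) (l : nat)
    (b : nat -> R) : state col L L0 l b -> (0 < l)%N ->
  K.+1%:R * (\sum_(1 <= m < K.+1) b m) <= 4^-1 ->
  exists2 f : V -> C, forall v, f v \in L0 v &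
    forall e c, e \in H -> exists2 v, v \in e & f v != c.
Proof.
move=> st l0 sumb; pose mu (v : V) (c : C) : R := if c \in L v then l%:R^-1 else 0.
have ln0 : l%:R != 0 :> R by rewrite pnatr_eq0 -lt0n.
have mu0 v c : 0 <= mu v c by rewrite /mu; case: ifP => // _; rewrite invr_ge0.
have mu1 v : \sum_c mu v c = 1.
  by rewrite -big_mkcond /= sumr_const (state_card st) -[_ *+ l]mulr_natr mulVf.
pose U (e : {set V}) := [set v in e | (e \in H) && (col v == None)].
pose B e (w : {ffun V -> C}) := (e \in H) &&
  [exists c, [forall v in e, if col v is Some d then d == c else (c \in L v) && (w v == c)]].
have BD e : depends_on (U e) (B e).
  move=> w w' ww'; rewrite /B; case: (boolP (e \in H)) => //= eH.
  apply: eq_existsb => c; apply: eq_forallb_in => v ve.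
  by case cv: (col v) => [d|] //; rewrite ww' // inE ve cv eH.
have UB e w : B e w -> exists v, v \in U e.
  case/andP => eH /existsP[c /forall_inP ec]; have [v ve cv] := state_proper st c eH.
  exists v; rewrite inE ve eH /=; apply: contraT; case cv0: (col v) => [d|//] _.
  by move: cv (ec v ve); rewrite cv0 => /negP + /eqP dc; rewrite dc eqxx.
have PB v e : v \in U e -> proba mu (B e) <=
    \sum_(c | (c \in L v) && alive col L e v c) l%:R^-1 ^+ #|live col e v|.+1.
  rewrite inE => /and3P[ve _ /eqP cv].
  pose Q c (w : {ffun V -> C}) := [forall x in v |: live col e v, w x == c].
  apply: (@le_trans _ _ (\sum_(c | (c \in L v) && alive col L e v c) proba mu (Q c))).
    apply: le_trans (proba_exists mu0 _ Q); apply: (proba_le mu0) => w.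
    case/andP => eH /existsP[c /forall_inP ec]; apply/existsP; exists c.
    have := ec v ve; rewrite cv => /andP[-> /eqP wv] /=; apply/andP; split.
      rewrite /alive eH ve; apply/forall_inP => x; rewrite !inE => /andP[_ xe].
      by have := ec x xe; case: (col x) => [d /eqP->|/andP[->]]; rewrite ?eqxx ?orbT.
    apply/forall_inP => x /setU1P[->|/liveP[xe _ cx]]; first by rewrite wv.
    by have := ec x xe; rewrite cx => /andP[].
  apply: ler_sum => c /andP[cL al]; pose S := v |: live col e v.
  have -> : proba mu (Q c) = expect mu (fun w => \prod_(x in S) (w x == c)%:R).
    apply: eq_expect => w; case: (boolP (Q c w)) => [/forall_inP Qc|].
      by rewrite big1 // => x xS; rewrite Qc.
    rewrite negb_forall => /existsP[x]; rewrite negb_imply => /andP[xl /negbTE xc].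
    by rewrite (bigD1 x) //= xc mul0r.
  rewrite (expect_prod_indep mu1 (A := fun x => [set x])); last 2 first.
  - by move=> x _ w w' ww'; rewrite ww' // inE.
  - by move=> x y _ _ xy; rewrite disjoints1 inE.
  rewrite (eq_bigr (fun=> l%:R^-1)); last first.
    move=> x xS; transitivity (proba mu (fun w => pred1 c (w x))) => //.
    rewrite (proba_coord mu1 x (pred1 c)).
    rewrite big_pred1_eq /mu; case/setU1P: xS => [->|xl]; first by rewrite cL.
    by rewrite (alive_live al xl).
  rewrite prodr_const /S cardsU1 (_ : v \notin live col e v) //.
  by apply/negP => /liveP[_]; rewrite eqxx.
have sumPB v : col v = None -> \sum_(e | v \in U e) proba mu (B e) <= \sum_(1 <= m < K.+1) b m.
  move=> cv.
  apply: (@le_trans _ _ (\sum_(e | v \in U e) \sum_(c | (c \in L v) && alive col L e v c)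
      l%:R^-1 ^+ #|live col e v|.+1)); first by apply: ler_sum => e; exact: PB.
  rewrite (exchange_big_dep (mem (L v))) /=; last by move=> e c _ /andP[].
  apply: (@le_trans _ _ (\sum_(c in L v) l%:R^-1 * (\sum_(1 <= m < K.+1) b m))); last first.
    by rewrite sumr_const (state_card st) -[X in X <= _]mulr_natl mulrA divff ?mul1r.
  apply: ler_sum => c cL.
  rewrite (eq_bigl (fun e => alive col L e v c)); last first.
    move=> e; rewrite /= cL /= andbC; case: (boolP (alive _ _ _ _ _)) => //= al.
    by case/aliveP: al => eH ve _; rewrite inE ve cv eH.
  under eq_bigr => e _ do rewrite exprS.
  rewrite -mulr_sumr ler_wpM2l ?invr_ge0 //.
  rewrite (sum_alive st (fun m => l%:R^-1 ^+ m)) // !big_nat.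
  apply: ler_sum => m mK; rewrite exprVn ler_pdivrMr ?exprn_gt0 ?ltr0n //.
  exact: state_deg st _ _ _ cv cL mK.
have [||e|e|e e'|e|w w0 wB] := @lovasz_local_lemma R _ _ mu _ _ _
    (fun e e' => (e == e') || ~~ [disjoint U e & U e']) U B => //.
- by rewrite eqxx.
- by rewrite negb_or negbK => /andP[].
- have [[v vU]|nU] := pselect (exists v, v \in U e); last first.
    rewrite big1 // => e' ee'.
    rewrite (_ : proba _ _ = 0) // -[RHS](expect_cst mu1 0); apply: eq_expect => w.
    case: (boolP (B e' w)) => // /UB[v vU]; case: nU; case/orP: ee' => [/eqP->|]; first by exists v.
    by case/pred0Pn => x /andP[/= xU _]; exists x.
  apply: le_trans sumb; apply: (@le_trans _ _ (\sum_(v in U e) \sum_(m <- index_iota 1 K.+1) b m)); last first.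
    rewrite sumr_const -[X in X <= _]mulr_natl ler_wpM2r // ?ler_nat.
      apply: le_trans (sumPB v _); first by apply: sumr_ge0 => e' _; exact: proba_ge0.
      by move: vU; rewrite inE => /and3P[_ _ /eqP].
    have eH : e \in H by move: vU; rewrite inE => /and3P[].
    rewrite -(uniH eH); apply/subset_leq_card/fintype.subsetP => x.
    by rewrite inE => /andP[].
  apply: (@le_trans _ _ (\sum_(x in U e) \sum_(e' | x \in U e') proba mu (B e'))).
    rewrite [X in _ <= X](exchange_big_dep xpredT) //= [X in X <= _]big_mkcond /=; apply: ler_sum => e' _.
    case: ifP => ee'; last by rewrite sumr_ge0 // => x _; exact: proba_ge0.
    have [x xe xe'] : exists2 x, x \in U e & x \in U e'.
      case/orP: ee' => [/eqP<-|]; first by exists v.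
      by case/pred0Pn => x /andP[/= xU xU']; exists x.
    rewrite (bigD1 x) ?xe ?xe' //= lerDl sumr_ge0 // => y _; exact: proba_ge0.
  by apply: ler_sum => x; rewrite inE => /and3P[_ _ /eqP cx]; exact: sumPB.
(* Since [w] has nonzero weight, [w v] lies in [L v] for every [v]. *)
- exists (fun v => if col v is Some d then d else w v) => [v|e c eH].
    case cv: (col v) => [d|]; first exact: state_col st _ _ cv.
    apply: (fintype.subsetP (state_sub st v)); apply: contraNT w0 => wL.
    by rewrite /weight (bigD1 v) //= /mu (negbTE wL) mul0r.
  apply/exists_inP; apply: contraT => /exists_inPn all_c; exfalso.
  have := wB e; rewrite /B eH /= => /existsP; apply; exists c.
  apply/forall_inP => v ve; have := all_c v ve; rewrite negbK => /eqP.
  case cv: (col v) => [d|] fc; first by rewrite fc.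
  rewrite fc eqxx andbT; apply: contraNT w0 => wL.
  by rewrite /weight (bigD1 v) //= /mu fc (negbTE wL) mul0r.
Qed.
End Nibble.

(** * Iterating the nibble *)

(** Both sides count pairs of nested subsets of sizes [j] and [m]. *)
Lemma mul_bin_bin n m j : (j <= m)%N -> (m <= n)%N ->
  ('C(n, m) * 'C(m, j) = 'C(n, j) * 'C(n - j, m - j))%N.
Proof.
move=> jm mn; have jn := leq_trans jm mn.
have mj : (m - j <= n - j)%N by rewrite leq_sub2r.
have e1 := bin_fact mn; have e2 := bin_fact jm; have e3 := bin_fact jn.
have e4 := bin_fact mj; have nm : (n - j - (m - j) = n - m)%N by rewrite subnBA // subnK.
rewrite nm in e4.
apply/eqP; rewrite -(@eqn_pmul2r (j`! * (m - j)`! * (n - m)`!)) ?muln_gt0 ?fact_gt0 //.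
apply/eqP; transitivity n`!.
  by rewrite -e1 -e2; ring.
by rewrite -e3 -e4; ring.
Qed.

(** * Binomial identities and numerical estimates *)

Section NibbleNumerics.
Variables (R : realType) (K : nat).
Implicit Types (lam x theta : R).

(* The bound on degrees after a proportion [x] of the vertices is coloured: each
   of the [K] other vertices of an edge is live with probability [1 - x]. *)
Definition deg_bound lam x (m : nat) : R :=
  lam * ('C(K, m)%:R * (1 - x) ^+ m * x ^+ (K - m)).

Lemma deg_bound_ge0 lam x m : 0 <= lam -> 0 <= x <= 1 -> 0 <= deg_bound lam x m.
Proof.
by move=> ? /andP[? ?]; rewrite !mulr_ge0 ?exprn_ge0 ?subr_ge0.
Qed.

(** Binomial expansion of [x + (1 - x) * theta], the coloured proportion after the round, without
    its term [m = 0]. The rate of deletion becomes a difference of [K]-th powers, which telescopes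
    over the rounds. *)
Lemma sum_deg_bound lam x theta :
  \sum_(1 <= m < K.+1) deg_bound lam x m * theta ^+ m =
  lam * ((x + (1 - x) * theta) ^+ K - x ^+ K).
Proof.
rewrite exprDn -(big_mkord xpredT (fun i => x ^+ (K - i) * ((1 - x) * theta) ^+ i *+ 'C(K, i))).
rewrite big_ltn // bin0 subn0 expr0 mulr1 mulr1n addrAC subrr add0r mulr_sumr.
by apply: eq_bigr => m _; rewrite /deg_bound exprMn -mulr_natl; ring.
Qed.

(** After [mul_bin_bin] extracts ['C(K, j)], a full binomial expansion in [m - j] remains. Hence
    thinned degrees have the same shape, with the coloured proportion advanced to
    [x + (1 - x) * theta]. *)
Lemma sum_deg_bound_thin lam x theta j : (j <= K)%N -> (0 < j)%N ->
  \sum_(1 <= m < K.+1) deg_bound lam x m * 'C(m, j)%:R * theta ^+ (m - j) =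
  lam * ('C(K, j)%:R * (1 - x) ^+ j * (x + (1 - x) * theta) ^+ (K - j)).
Proof.
move=> jK j0; rewrite (big_cat_nat (n := j)) //=; last exact: leqW.
rewrite big_nat big1 ?add0r => [|m /andP[_ mj]]; last by rewrite bin_small // mulr0 mul0r.
rewrite -{1}[j]add0n big_addn subSn // big_mkord [(x + _) ^+ (K - j)]exprDn !mulr_sumr.
apply: eq_bigr => i _; have ij : (i <= K - j)%N by rewrite -ltnS.
have jiK : (i + j <= K)%N by rewrite addnC -leq_subRL.
have /(congr1 (fun n => n%:R : R)) := @mul_bin_bin K (i + j) j (leq_addl _ _) jiK.
rewrite !natrM addnK => e; rewrite /deg_bound.
have -> : lam * ('C(K, i + j)%:R * (1 - x) ^+ (i + j) * x ^+ (K - (i + j))) * 'C(i + j, j)%:R * theta ^+ i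
  = lam * ('C(K, i + j)%:R * 'C(i + j, j)%:R) * ((1 - x) ^+ (i + j) * x ^+ (K - (i + j)) * theta ^+ i) by ring.
by rewrite e exprMn -mulr_natl exprD addnC subnDA; ring.
Qed.

(** Superadditivity of powers. It bounds the deletion rate of a round below by [lam * h ^+ K], which
    keeps the exponent of the tail bound large. *)
Lemma exprB_ge (x y : R) n : 0 <= x -> x <= y -> (0 < n)%N ->
  (y - x) ^+ n <= y ^+ n - x ^+ n.
Proof.
move=> x0 xy; case: n => // n _; elim: n => [|n IH]; first by rewrite !expr1.
have y0 : 0 <= y by exact: le_trans xy.
rewrite exprS (exprS y) (exprS x).
have : (y - x) * (y - x) ^+ n.+1 <= (y - x) * (y ^+ n.+1 - x ^+ n.+1).
  by rewrite ler_wpM2l // subr_ge0.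
have : x * x ^+ n.+1 <= x * y ^+ n.+1 by rewrite ler_wpM2l // lerXn2r.
have : 0 <= (y - x) * x ^+ n.+1 by rewrite mulr_ge0 ?subr_ge0 ?exprn_ge0.
lra.
Qed.

Lemma exprB_le (x y : R) n : 0 <= x -> x <= y -> y <= 1 ->
  y ^+ n - x ^+ n <= n%:R * (y - x).
Proof.
move=> x0 xy y1; elim: n => [|n IH]; first by rewrite !expr0 mul0r subrr.
have y0 : 0 <= y by exact: le_trans xy.
rewrite (exprS y) (exprS x) -natr1.
have : y * (y ^+ n - x ^+ n) <= 1 * (n%:R * (y - x)).
  apply: ler_pM => //; rewrite subr_ge0 lerXn2r //.
have : (y - x) * x ^+ n <= (y - x) * 1.
  by rewrite ler_wpM2l ?subr_ge0 // exprn_ile1 // (le_trans xy).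
lra.
Qed.

(** It suffices that [(1 - y) * (1 + y + 2 * y ^+ 2) >= 1], that is, [y ^+ 2 * (1 - 2 * y) >= 0]. *)
Lemma expR_le1Bx (y : R) : 0 <= y <= 2^-1 -> expR (- (y + 2 * y ^+ 2)) <= 1 - y.
Proof.
case/andP=> y0 y1; have h := expR_ge1Dx (y + 2 * y ^+ 2).
rewrite expRN; apply: (@le_trans _ _ (1 + (y + 2 * y ^+ 2))^-1).
  rewrite lef_pV2 ?posrE ?expR_gt0 //; nra.
rewrite -[X in X <= _]div1r ler_pdivrMr; nra.
Qed.

(* [S] exceeds the factor [l' / l] by which lists shrink only by [exp] of a
   second-order error, so that the bounds on degrees relative to powers of the
   list size are almost preserved. *)
Lemma step_numbers (eta rho lmin theta r : R) (l : nat) :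
  0 < eta -> eta <= 4^-1 -> rho <= 4^-1 -> 2 <= lmin -> lmin <= l%:R ->
  0 <= theta -> theta <= 2^-1 -> 0 < r -> r <= rho ->
  exists l' (S : R),
   [/\ (l' <= l)%N, l'%:R < l%:R - (1 + eta) ^+ 2 * (r * l%:R) + 1,
    stay_rate l theta r <= (1 - theta) * S &
    [/\ 0 <= S, lmin / 2 <= S * l%:R &
    S * l%:R <= l'%:R * expR (lmin^-1 + 4 * theta * (lmin^-1 + rho) +
                3 * (eta * rho) + 8 * rho ^+ 2)]] /\
    l%:R * expR (- (r + (3 * (eta * rho) + 8 * rho ^+ 2))) <= l'%:R.
Proof.
move=> eta0 eta4 rho4 lmin2 lminl th0 th1 r0 r_rho.
have l2 : 2 <= l%:R :> R by exact: le_trans lminl.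
have l0 : (0 < l)%N by rewrite -(ltr_nat R) (lt_le_trans _ l2).
have thle1 : theta <= 1 by lra.
pose y := (1 + eta) ^+ 2 * r.
have ee : eta * eta <= eta * 4^-1 by rewrite ler_wpM2l // ltW.
have e2 : (1 + eta) ^+ 2 <= 1 + 3 * eta.
  have -> : (1 + eta) ^+ 2 = 1 + 2 * eta + eta * eta by ring.
  lra.
have ye : y <= (1 + 3 * eta) * r by rewrite ler_wpM2r // ltW.
have er : eta * r <= eta * rho by rewrite ler_wpM2l // ltW.
have er4 : eta * r <= 4^-1 * r by rewrite ler_wpM2r // ltW.
have yr : y - r <= 3 * (eta * rho) by lra.
have y2 : y <= 2 * rho by lra.
have y0 : 0 <= y by rewrite mulr_ge0 ?exprn_ge0 ?(ltW r0) //; lra.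
have y1 : y <= 2^-1 by lra.
have yy : y ^+ 2 <= 4 * rho ^+ 2.
  have -> : 4 * rho ^+ 2 = (2 * rho) ^+ 2 by ring.
  by rewrite lerXn2r ?nnegrE ?(le_trans y0 y2).
clear ee e2 ye er er4.
have yl0 : 0 <= y * l%:R by rewrite mulr_ge0.
have /andP[t1 t2] := truncn_itv yl0.
(* The loss is rounded down, so [l'] is at least [l%:R * (1 - y)] and exceeds it by less than 1. *)
set l' := (l - Num.truncn (y * l%:R))%N.
have tl : (Num.truncn (y * l%:R) <= l)%N.
  by rewrite -(ler_nat R) (le_trans t1) // -[X in _ <= X]mul1r ler_wpM2r //; lra.
have l'E : l'%:R = l%:R - (Num.truncn (y * l%:R))%:R :> R by rewrite natrB.
have l'_ge : l%:R * (1 - y) <= l'%:R by rewrite l'E; lra.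
have l'_lt : l'%:R < l%:R - (1 + eta) ^+ 2 * (r * l%:R) + 1.
  by rewrite l'E mulrA -/y; rewrite -natr1 in t2; lra.
have l'_exp : l%:R * expR (- (y + 2 * y ^+ 2)) <= l'%:R.
  by apply: le_trans l'_ge; rewrite ler_wpM2l // expR_le1Bx // y0 y1.
clear t1 t2 l'E l'_ge.
have il : l%:R^-1 <= lmin^-1 by rewrite lef_pV2 ?posrE //; lra.
have il0 : 0 <= lmin^-1 by rewrite invr_ge0; lra.
have rho0 : 0 <= rho by lra.
(* The first term covers the [pr_pick] in the exponent of [stay_rate]. The second covers the summand
   [pr_pick + theta * r], at most [theta * (lmin^-1 + rho)]; the factor 4 appears because the main
   term of [stay_rate] is at least [4^-1]. *)
pose sigma := lmin^-1 + 4 * theta * (lmin^-1 + rho).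
have sigma0 : 0 <= sigma by rewrite /sigma !addr_ge0 ?mulr_ge0 ?addr_ge0.
pose S := expR (- r + sigma).
have stayS : stay_rate l theta r <= (1 - theta) * S.
  have t_le := pr_pick_le l0 thle1; have t_ge := pr_pick_ge0 l th0.
  rewrite /stay_rate; set t := pr_pick l theta in t_le t_ge *.
  have tE : t <= theta * lmin^-1 by rewrite /t /pr_pick ler_wpM2l.
  have ert : 2^-1 <= expR (- r + t) by have := expR_ge1Dx (- r + t); lra.
  have -> : S = expR (- r + t) * expR (sigma - t) by rewrite -expRD; congr expR; ring.
  have es : 1 + 4 * theta * (lmin^-1 + rho) <= expR (sigma - t).
    have := expR_ge1Dx (sigma - t); rewrite {1}/sigma; lra.
  apply: (@le_trans _ _ ((1 - theta) * (expR (- r + t) * (1 + 4 * theta * (lmin^-1 + rho))))).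
    have h1 : theta * r <= theta * rho by rewrite ler_wpM2l.
    have h2 : 0 <= theta * (lmin^-1 + rho) by rewrite mulr_ge0 ?addr_ge0.
    have h3 : 4^-1 <= (1 - theta) * expR (- r + t).
      have -> : 4^-1 = 2^-1 * 2^-1 :> R by field.
      by apply: ler_pM => //; lra.
    have h4 : 4^-1 * (4 * (theta * (lmin^-1 + rho))) <=
      (1 - theta) * expR (- r + t) * (4 * (theta * (lmin^-1 + rho))).
      by apply: ler_wpM2r => //; lra.
    lra.
  by rewrite !ler_wpM2l ?expR_ge0 //; lra.
exists l', S; split; first (split=> //; first exact: leq_subr; split).
- exact: expR_ge0.
- have S2 : 2^-1 <= S by have := expR_ge1Dx (- r + sigma); rewrite -/S; lra.
  rewrite mulrC; apply: ler_pM => //; lra.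
- apply: (@le_trans _ _ (l%:R * expR (- (y + 2 * y ^+ 2)) *
      expR (sigma + 3 * (eta * rho) + 8 * rho ^+ 2))); last by rewrite ler_wpM2r ?expR_ge0.
  rewrite -mulrA -expRD mulrC ler_wpM2l // ler_expR; lra.
- by apply: le_trans l'_exp; rewrite ler_wpM2l // ler_expR; lra.
Qed.

(** * Composition of the rounds *)

Variables (V C : finType) (H : {set {set V}}).
Hypotheses (uniH : uniform K.+1 H) (uncrH : uncrowded H).
Variables (L0 : V -> {set C}) (Delta q : nat) (eta xi rho lmin h A : R).
Hypotheses (degH : (max_degree H <= Delta)%N) (K_gt0 : (0 < K)%N).
Hypotheses (eta_gt0 : 0 < eta) (eta_le : eta <= 4^-1) (rho_le : rho <= 4^-1).
Hypotheses (lmin_ge2 : 2 <= lmin) (h_gt0 : 0 < h).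
Hypothesis failure_le : ((1 + Delta * K.+1) ^ 4 * (1 + q * K.+1 * q.+1))%:R * expR (- A) <= 4^-1.

(** As [(1 - x) * theta = h], the coloured proportion grows by exactly [h], and [r] is taken to be
    [lam * ((x + h) ^+ K - x ^+ K)]. All errors, from concentration, rounding and failed tries, go
    into the factor [expR xi] on [lam]. *)
Lemma nibble_step (col : V -> option C) (L : V -> {set C}) (l : nat) (lam x theta : R) :
  state H K col L L0 l (deg_bound lam x) -> (l <= q)%N -> lmin <= l%:R ->
  0 < lam -> 0 <= x -> 0 <= theta <= 2^-1 -> (1 - x) * theta = h -> h <= 1 - (x + h) ->
  lam * (K%:R * h) <= rho ->
  2 * eta + K%:R * (lmin^-1 + 4 * theta * (lmin^-1 + rho) + 3 * (eta * rho) + 8 * rho ^+ 2) <= xi ->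
  A <= eta ^+ 2 * (lam * h ^+ K * (lmin / 2)) ->
  exists l' col' L', [/\ state H K col' L' L0 l' (deg_bound (lam * expR xi) (x + h)),
     (l' <= l)%N & l%:R * expR (- (lam * ((x + h) ^+ K - x ^+ K) + xi)) <= l'%:R].
Proof.
have [eta0 eta4 rho4] : [/\ 0 < eta, eta <= 4^-1 & rho <= 4^-1] by [].
have [lmin2 h0] : 2 <= lmin /\ 0 < h by [].
move=> st lq lminl lam0 x0 /andP[th0 th1] hE hx rhoP xiP AP.
have thle1 : theta <= 1 by lra.
set x' := x + h; have x'E : x + (1 - x) * theta = x' by rewrite hE.
have l2 : 2 <= l%:R :> R by exact: le_trans lminl.
have l0 : (0 < l)%N by rewrite -(ltr_nat R) (lt_le_trans _ l2).
have xx' : x <= x' by rewrite lerDl ltW.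
have x'1 : x' <= 1 by rewrite /x'; lra.
have x01 : 0 <= x <= 1 by rewrite x0 (le_trans xx').
pose r := lam * (x' ^+ K - x ^+ K).
have r_rho : r <= rho.
  apply: le_trans rhoP; rewrite ler_wpM2l ?(ltW lam0) //.
  by have := exprB_le K x0 xx' x'1; rewrite /x' [x + h - x]addrAC subrr add0r.
have r_ge : lam * h ^+ K <= r.
  rewrite ler_wpM2l ?(ltW lam0) //.
  by have := exprB_ge x0 xx' K_gt0; rewrite /x' [x + h - x]addrAC subrr add0r.
have r0 : 0 < r by apply: lt_le_trans r_ge; rewrite mulr_gt0 ?exprn_gt0.
have K1 : 1 <= K%:R :> R by rewrite ler1n.
have il0 : 0 <= lmin^-1 by rewrite invr_ge0; lra.
have rho0 : 0 <= rho by lra.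
have [l' [S [[l'l l'_lt stayS [S0 Sl1 Sl]] l'_exp]]] :=
  step_numbers eta0 eta4 rho4 lmin2 lminl th0 th1 r0 r_rho.
(* Bounds on the expected degrees after the round, with [S] in place of the true ratio [l' / l]. *)
pose mu j := lam * ('C(K, j)%:R * (1 - x') ^+ j * x' ^+ (K - j)) * (S * l%:R) ^+ j.
have stay0 : 0 <= stay_rate l theta r.
  apply: addr_ge0; first by rewrite mulr_ge0 ?expR_ge0 ?subr_ge0.
  exact: addr_ge0 (pr_pick_ge0 _ th0) (mulr_ge0 th0 (ltW r0)).
have [col' [L' st']] : exists col' L', state H K col' L' L0 l' (deg_bound (lam * expR xi) x').
  apply: (nibble_round uniH uncrH (mu := mu) (theta := theta) (r := r) (eta := eta) (A := A)
    degH st l0) => //.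
  - by rewrite th0 /=; lra.
  - by move=> m; rewrite deg_bound_ge0 // ltW.
  - by rewrite sum_deg_bound x'E.
  - lra.
  - move=> j /andP[j0 jK]; split.
      apply: (@le_trans _ _ ((((1 - theta) * S) ^+ j * l%:R ^+ j) *
         \sum_(1 <= m < K.+1) (deg_bound lam x m * 'C(m, j)%:R * theta ^+ (m - j)))).
        rewrite mulr_sumr; apply: ler_sum => m _.
        have -> : deg_bound lam x m * 'C(m, j)%:R * stay_rate l theta r ^+ j *
          theta ^+ (m - j) * l%:R ^+ j = (stay_rate l theta r ^+ j * l%:R ^+ j) *
            (deg_bound lam x m * 'C(m, j)%:R * theta ^+ (m - j)) by ring.
        rewrite ler_wpM2r //.
          apply: mulr_ge0; last exact: exprn_ge0.
          by apply: mulr_ge0 => //; apply: deg_bound_ge0 => //; exact: ltW.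
        rewrite ler_wpM2r ?exprn_ge0 // lerXn2r // nnegrE mulr_ge0 //; lra.
      rewrite sum_deg_bound_thin // x'E /mu.
      have -> : 1 - x' = (1 - x) * (1 - theta) by rewrite -x'E; ring.
      by rewrite !exprMn le_eqVlt; apply/orP; left; apply/eqP; ring.
    rewrite /mu /deg_bound mulrA.
    set c := _%:R * _ * _.
    have c0 : 0 <= c by rewrite !mulr_ge0 ?exprn_ge0 //; lra.
    have -> : (1 + eta) ^+ 2 * (lam * c) * (S * l%:R) ^+ j =
      (lam * c) * ((1 + eta) ^+ 2 * (S * l%:R) ^+ j) by ring.
    have -> : lam * expR xi * c * l'%:R ^+ j = (lam * c) * (expR xi * l'%:R ^+ j) by ring.
    apply: ler_wpM2l; first by rewrite mulr_ge0 // ltW.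
    set tau := lmin^-1 + _ + _ + _ in Sl xiP.
    have tau0 : 0 <= tau.
      by rewrite /tau !addr_ge0 ?mulr_ge0 ?addr_ge0 ?exprn_ge0 // ltW.
    (* The concentration loss is [(1 + eta) ^+ 2 <= expR (2 * eta)]; the loss [expR tau] in the list
       size occurs [j <= K] times. *)
    apply: (@le_trans _ _ (expR (2 * eta) * (l'%:R ^+ j * expR (K%:R * tau)))).
      apply: ler_pM; rewrite ?exprn_ge0 ?mulr_ge0 ?expR_ge0 //; first lra.
        rewrite -[2 * eta]/(2%:R * eta) expRM_natl lerXn2r ?nnegrE ?expR_ge0 //; first lra.
        exact: expR_ge1Dx.
      apply: (@le_trans _ _ ((l'%:R * expR tau) ^+ j)).
        by rewrite lerXn2r // nnegrE ?mulr_ge0 ?expR_ge0.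
      rewrite exprMn ler_wpM2l ?exprn_ge0 // -expRM_natl ler_expR ler_wpM2r //.
      by rewrite ler_nat.
    rewrite mulrCA mulrA [expR xi * _]mulrC -mulrA ler_wpM2l ?exprn_ge0 //.
    by rewrite -expRD ler_expR.
  - apply: le_trans AP _; rewrite ler_wpM2l ?exprn_ge0 ?(ltW eta_gt0) //.
    apply: ler_pM => //; [|lra|lra]; by rewrite mulr_ge0 ?exprn_ge0 // ltW.
  - move=> j /andP[j0 jK]; apply: le_trans AP _; rewrite ler_wpM2l ?exprn_ge0 ?(ltW eta_gt0) //.
    have hh : h ^+ K <= 'C(K, j)%:R * (1 - x') ^+ j * x' ^+ (K - j).
      have -> : h ^+ K = 1 * h ^+ j * h ^+ (K - j) by rewrite mul1r -exprD subnKC.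
      have x'h : h <= x' by rewrite /x' lerDr.
      by rewrite !ler_pM ?mulr_ge0 ?exprn_ge0 ?lerXn2r ?nnegrE ?ler1n ?bin_gt0 ?(ltW h_gt0) //;
        lra.
    rewrite /mu; apply: ler_pM; rewrite ?mulr_ge0 ?exprn_ge0 ?(ltW lam0) ?(ltW h_gt0) //.
    + by lra.
    + by rewrite ler_wpM2l // ltW.
    + apply: (le_trans Sl1); rewrite -{1}[S * _]expr1 ler_weXn2l //; lra.
  - apply: le_trans failure_le; rewrite ler_wpM2r ?expR_ge0 // ler_nat leq_mul2l.
    by apply/orP; right; rewrite leq_add2l !leq_mul.
exists l', col', L'; split=> //.
apply: le_trans l'_exp; rewrite ler_wpM2l // ler_expR -/r lerN2 lerD2l.
apply: le_trans xiP; rewrite -[X in X <= _]add0r lerD ?mulr_ge0 ?(ltW eta0) //.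
rewrite -[X in X <= _]mul1r ler_pM ?addr_ge0 ?mulr_ge0 ?exprn_ge0 ?(ltW eta0) //.
by rewrite -addrA lerDr addr_ge0 ?mulr_ge0 ?addr_ge0.
Qed.

(** While nothing is coloured, an edge has exactly [K] live vertices besides [v]; accordingly
    [deg_bound lam 0 m] is 0 for [m < K] and [lam] for [m = K]. *)
Lemma initial_state (lam : R) : (forall v, #|L0 v| = q) -> Delta%:R <= lam * q%:R ^+ K ->
  state H K (fun=> None) L0 L0 q (deg_bound lam 0).
Proof.
move=> L0q Dlam; split=> //.
- move=> e c eH; have /card_gt0P[v ve] : (0 < #|e|)%N by rewrite (uniH eH).
  by exists v.
- move=> v c e _ _ /aliveP[eH ve _].
  have /card_gt0P[w] : (0 < #|e :\ v|)%N by have := cardsD1 v e; rewrite ve (uniH eH) add1n => -[<-].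
  rewrite !inE => /andP[wv we]; apply/card_gt0P; exists w; exact/liveP.
- move=> v c m _ _ /andP[m0 mK].
  case: (ltnP m K) => [ltmK|Km].
    rewrite (_ : cdeg _ _ _ _ _ _ = 0%N).
      rewrite /deg_bound expr0n subn_eq0 leqNgt ltmK /= !mulr0 mul0r //.
    apply/eqP; rewrite cards_eq0; apply/eqP/setP => e; rewrite !inE; apply/negP.
    case/andP => /aliveP[eH ve _] /eqP em.
    have : #|e :\ v| = K by have := cardsD1 v e; rewrite ve (uniH eH) => -[].
    rewrite (_ : e :\ v = live (fun=> @None C) e v) ?em => [mK'|]; first by rewrite mK' ltnn in ltmK.
    by apply/setP => x; rewrite /live !inE eqxx andbT.
  have -> : m = K by apply/eqP; rewrite eqn_leq mK.
  rewrite /deg_bound binn subnn subr0 expr1n !mulr1; apply: le_trans Dlam; rewrite ler_nat.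
  apply: leq_trans (degree_le degH v); apply/subset_leq_card/fintype.subsetP => e.
  by rewrite !inE => /andP[/aliveP[-> -> _]].
Qed.

Variables (M N : nat) (lam0 Lam : R).
Hypotheses (M_ge2 : (2 <= M)%N) (NE : N = (M * M)%N) (hE : h = N%:R^-1).
Hypotheses (L0_card : forall v, #|L0 v| = q) (Delta_le : Delta%:R <= lam0 * q%:R ^+ K).
Hypotheses (lam0_gt0 : 0 < lam0) (Lam_ge : lam0 * expR (N%:R * xi) <= Lam).
Hypothesis rho_ge : Lam * (K%:R * h) <= rho.
Hypothesis lmin_le : lmin <= q%:R * expR (- (Lam + N%:R * xi)).
Hypothesis xi_ge : 2 * eta + K%:R * (lmin^-1 + 4 * M%:R^-1 * (lmin^-1 + rho) +
  3 * (eta * rho) + 8 * rho ^+ 2) <= xi.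
Hypothesis A_le : A <= eta ^+ 2 * (lam0 * h ^+ K * (lmin / 2)).

Lemma xi_ge0 : 0 <= xi.
Proof.
have [eta0 lmin2 h0] : [/\ 0 < eta, 2 <= lmin & 0 < h] by [].
have il0 : 0 <= lmin^-1 by rewrite invr_ge0; lra.
have Lam0 : 0 < Lam by apply: lt_le_trans Lam_ge; rewrite mulr_gt0 ?expR_gt0.
have rho0 : 0 <= rho by apply: le_trans rho_ge; rewrite !mulr_ge0 ?(ltW Lam0) ?(ltW h0).
have iM0 : 0 <= M%:R^-1 :> R by rewrite invr_ge0.
apply: le_trans xi_ge; apply: addr_ge0; first by rewrite mulr_ge0 // ltW.
rewrite mulr_ge0 // !addr_ge0 ?mulr_ge0 ?addr_ge0 ?exprn_ge0 ?mulr_ge0 ?(ltW eta0) //.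
Qed.

(** Each round advances the coloured proportion by [h = 1 / N], and [N - M] rounds leave
    [M / N = 1 / M] live. In the list bound the current density is replaced by its upper bound
    [Lam], which makes the deletion rates telescope to [Lam * (i%:R * h) ^+ K]. *)
Lemma nibble_rounds i : (i <= N - M)%N -> exists col L l,
  [/\ state H K col L L0 l (deg_bound (lam0 * expR (i%:R * xi)) (i%:R * h)), (l <= q)%N,
      lmin <= l%:R & q%:R * expR (- (Lam * (i%:R * h) ^+ K + i%:R * xi)) <= l%:R].
Proof.
have [eta0 lmin2 h0] : [/\ 0 < eta, 2 <= lmin & 0 < h] by [].
have [lamp LamG] : 0 < lam0 /\ lam0 * expR (N%:R * xi) <= Lam by [].
have il0 : 0 <= lmin^-1 by rewrite invr_ge0; lra.
have Lam0 : 0 < Lam by apply: lt_le_trans LamG; rewrite mulr_gt0 ?expR_gt0.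
have rho0 : 0 <= rho by apply: le_trans rho_ge; rewrite !mulr_ge0 ?(ltW Lam0) ?(ltW h0).
have MM : M%:R <= N%:R :> R by rewrite ler_nat NE leq_pmull // (leq_trans _ M_ge2).
have M2 : 2 <= M%:R :> R by rewrite (ler_nat R 2).
have iM0 : 0 <= M%:R^-1 :> R by rewrite invr_ge0.
have xi0 := xi_ge0.
have N0 : 0 < N%:R :> R by lra.
have Nh : N%:R * h = 1 by rewrite hE divff // gt_eqF.
have lminP (l i' : nat) : (i' <= N - M)%N ->
    q%:R * expR (- (Lam * (i'%:R * h) ^+ K + i'%:R * xi)) <= l%:R -> lmin <= l%:R.
  move=> i'N; apply: le_trans; apply: le_trans lmin_le _.
  rewrite ler_wpM2l // ler_expR lerN2; have i'N' : (i' <= N)%N by rewrite (leq_trans i'N) ?leq_subr.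
  apply: lerD; last by rewrite ler_wpM2r // ler_nat.
  rewrite -[X in _ <= X]mulr1 ler_wpM2l ?(ltW Lam0) // exprn_ile1 // ?mulr_ge0 ?(ltW h0) //.
  by rewrite -[X in _ <= X]Nh ler_wpM2r ?(ltW h0) // ler_nat.
elim: i => [_|i IH iN].
  have q0 : q%:R * expR (- (Lam * (0%:R * h) ^+ K + 0%:R * xi)) <= q%:R.
    by rewrite !mul0r expr0n eqn0Ngt K_gt0 mulr0 addr0 oppr0 expR0 mulr1.
  exists (fun=> None), L0, q; split=> //; last exact: lminP q0.
  by rewrite !mul0r expR0 mulr1; apply: initial_state.
have {IH} [col [L [l [st lq lminl lbig]]]] := IH (ltnW iN).
have iNM : (i + M < N)%N by rewrite addnC -ltn_subRL.
have iNMr : i%:R + M%:R + 1 <= N%:R :> R by rewrite -natrD natr1 ler_nat.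
(* Trying with probability [1 / (N - i)] makes every increment equal to [h]; stopping [M] rounds
   early keeps it at most [1 / M]. *)
pose x := i%:R * h; pose theta := (N%:R - i%:R)^-1 : R.
have Ni0 : 0 < N%:R - i%:R :> R by lra.
have th0 : 0 <= theta by rewrite invr_ge0 ltW.
have thM : theta <= M%:R^-1 by rewrite lef_pV2 ?posrE //; lra.
have M2' : M%:R^-1 <= 2^-1 :> R by rewrite lef_pV2 ?posrE //; lra.
have x0 : 0 <= x by rewrite mulr_ge0 ?(ltW h0).
have xh : (1 - x) * theta = h.
  have -> : 1 - x = (N%:R - i%:R) * h by rewrite mulrBl Nh.
  by rewrite mulrAC /theta divff ?mul1r // gt_eqF.
have hx : h <= 1 - (x + h).
  have : (i%:R + 2) * h <= N%:R * h by rewrite ler_wpM2r ?(ltW h0) //; lra.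
  rewrite Nh /x; lra.
have iNle : expR (i%:R * xi) <= expR (N%:R * xi).
  by rewrite ler_expR ler_wpM2r // ler_nat (leq_trans _ (ltnW iNM)) // leq_addr.
have lamL : lam0 * expR (i%:R * xi) <= Lam.
  by apply: le_trans LamG; rewrite ler_wpM2l // ltW.
have Kh0 : 0 <= K%:R * h by rewrite mulr_ge0 // ltW.
have lami0 : 0 < lam0 * expR (i%:R * xi) by rewrite mulr_gt0 ?expR_gt0.
have [||||l' [col' [L' [st' l'l l'P]]]] := nibble_step (theta := theta) st lq lminl lami0 x0 _ xh hx.
- by rewrite th0 (le_trans thM).
- by apply: le_trans rho_ge; rewrite ler_wpM2r.
- apply: le_trans xi_ge; rewrite lerD2l ler_wpM2l // !lerD2r lerD2l.
  by rewrite ler_wpM2r ?addr_ge0 // ler_wpM2l.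
- apply: le_trans A_le _; rewrite ler_wpM2l ?exprn_ge0 ?(ltW eta0) //.
  rewrite !ler_wpM2r ?exprn_ge0 ?(ltW h0) //; first lra.
  rewrite -[X in X <= _]mulr1 ler_wpM2l ?(ltW lamp) // -[1]expR0 ler_expR mulr_ge0 //.
have e1 : i.+1%:R * h = x + h by rewrite -natr1 mulrDl mul1r.
have e2 : lam0 * expR (i.+1%:R * xi) = lam0 * expR (i%:R * xi) * expR xi.
  by rewrite -natr1 mulrDl mul1r expRD mulrA.
have big' : q%:R * expR (- (Lam * (i.+1%:R * h) ^+ K + i.+1%:R * xi)) <= l'%:R.
  apply: le_trans l'P; rewrite e1.
  apply: (@le_trans _ _ (q%:R * expR (- (Lam * x ^+ K + i%:R * xi)) *
     expR (- (lam0 * expR (i%:R * xi) * ((x + h) ^+ K - x ^+ K) + xi)))); last first.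
    by rewrite ler_wpM2r ?expR_ge0.
  rewrite -mulrA -expRD ler_wpM2l // ler_expR.
  have : lam0 * expR (i%:R * xi) * ((x + h) ^+ K - x ^+ K) <= Lam * ((x + h) ^+ K - x ^+ K).
    rewrite ler_wpM2r // subr_ge0 lerXn2r ?nnegrE ?addr_ge0 ?(ltW h0) //; lra.
  rewrite -natr1; lra.
exists col', L', l'; split=> //; last exact: lminP big'.
  by rewrite e1 e2.
exact: leq_trans lq.
Qed.

(** With live proportion [1 / M] left, [sum_deg_bound] at [theta = 1] adds up all remaining degree
    bounds to at most [K%:R * Lam / M%:R], small enough for [finish_coloring]. *)
Lemma nibble_coloring : K.+1%:R * (K%:R * Lam / M%:R) <= 4^-1 ->
  exists2 f : V -> C, forall v, f v \in L0 v &
    forall e c, e \in H -> exists2 v, v \in e & f v != c.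
Proof.
move=> KLam; have [lamp LamG] : 0 < lam0 /\ lam0 * expR (N%:R * xi) <= Lam by [].
have [lmin2 [eta0 h0]] : 2 <= lmin /\ 0 < eta /\ 0 < h by [].
have [col [L [l [st _ lminl _]]]] := nibble_rounds (leqnn _).
have l0 : (0 < l)%N by rewrite -(ltr_nat R); lra.
apply: (finish_coloring uniH st l0); apply: le_trans KLam; rewrite ler_wpM2l //.
have MN : (M <= N)%N by rewrite NE leq_pmull // (leq_trans _ M_ge2).
have M0 : 0 < M%:R :> R by rewrite ltr0n (leq_trans _ M_ge2).
have x1 : 1 - (N - M)%:R * h = M%:R^-1 :> R.
  rewrite natrB // hE NE natrM mulrBl invfM; field; lra.
have x01 : 0 <= (N - M)%:R * h by rewrite mulr_ge0 // ltW.
have xle1 : (N - M)%:R * h <= 1 by rewrite -subr_ge0 x1 invr_ge0.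
set X := (N - M)%:R * h in st x1 x01 xle1 *.
have := sum_deg_bound (lam0 * expR ((N - M)%:R * xi)) X 1.
have -> : X + (1 - X) * 1 = 1 by ring.
under eq_bigr => m _ do rewrite expr1n mulr1.
move=> ->.
have Lam0 : 0 <= Lam by apply: le_trans LamG; rewrite mulr_ge0 ?expR_ge0 // ltW.
have d := exprB_le K x01 xle1 (lexx 1); rewrite x1 in d.
have -> : K%:R * Lam / M%:R = Lam * (K%:R / M%:R) by ring.
apply: ler_pM => //.
- by rewrite mulr_ge0 ?expR_ge0 // ltW.
- by rewrite subr_ge0 expr1n exprn_ile1.
- apply: le_trans LamG; rewrite ler_wpM2l ?(ltW lamp) // ler_expR.
  by rewrite ler_wpM2r ?xi_ge0 // ler_nat leq_subr.
Qed.

End NibbleNumerics.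

(** * Asymptotics *)

(** Selecting [q] colours from each list bounds all of them by one maximum, so an ordinal type can
    serve as [C]. *)
Lemma choosable_finite_lists (V : finType) (H : {set {set V}}) (q : nat) :
  (forall (C : finType) (L0 : V -> {set C}), (forall v, #|L0 v| = q) ->
    exists2 f : V -> C, forall v, f v \in L0 v &
      forall e c, e \in H -> exists2 v, v \in e & f v != c) ->
  choosable H q.
Proof.
move=> finH L HL.
have inj v : exists g : nat -> nat, (forall i, (i < q)%N -> L v (g i)) /\
    (forall i j, (i < q)%N -> (j < q)%N -> g i = g j -> i = j).
  have /pcard_leP[g] := HL v; exists g; split=> [i iq|i j iq jq gij].
    by apply: (@funS _ _ _ _ g).
  by apply: (@inj _ _ _ g) => //; rewrite inE.
have {inj} [g gP] := choice inj.
pose m := (\max_(v : V) \max_(i < q) g v i)%N.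
have gm v (i : 'I_q) : (g v i < m.+1)%N.
  rewrite ltnS; apply: leq_trans (leq_bigmax v).
  exact: (leq_bigmax (F := fun j : 'I_q => g v j) i).
pose L0 v := [set Ordinal (gm v i) | i : 'I_q].
have L0q v : #|L0 v| = q.
  rewrite card_imset ?card_ord // => i j [] /(proj2 (gP v) _ _ (ltn_ord i) (ltn_ord j)).
  exact: val_inj.
have [f fL0 fH] := finH _ L0 L0q.
exists (fun v => val (f v)) => [e eH [c fc]|v]; last first.
  have /imsetP[i _ ->] := fL0 v; exact: (proj1 (gP v)).
(* The dummy colour [ord0] merely yields a vertex of [e]; the colour of that vertex is the one
   refuted next. *)
have [v0 v0e _] := fH e ord0 eH.
have [v ve /eqP] := fH e (f v0) eH; apply.
by apply: val_inj; rewrite /= (fc v ve) (fc v0 v0e).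
Qed.

(** * Choice of parameters for large degree *)

Section Asymptotics.
Variable R : realType.
Implicit Types (z b delta gam : R) (K E n : nat).

Lemma expR_le1D2x (a : R) : 0 <= a <= 2^-1 -> expR a <= 1 + 2 * a.
Proof.
case/andP=> a0 a1; have := expR_ge1Dx (- a); rewrite expRN => h.
have e0 := expR_gt0 a; have : (1 - a) * expR a <= 1.
  by rewrite -[X in _ <= X](mulVf (lt0r_neq0 e0)) ler_wpM2r // ltW.
nra.
Qed.

Lemma expRN1_ge : 4^-1 <= expR (- 1) :> R.
Proof.
have -> : - 1 = 2%:R * - 2^-1 :> R by field.
rewrite expRM_natl (_ : 4^-1 = (2^-1) ^+ 2 :> R); last by field.
rewrite lerXn2r ?nnegrE ?expR_ge0 //.
have := expR_ge1Dx (- 2^-1 : R); lra.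
Qed.

Lemma expRN2_le : expR (- 2) <= 4^-1 :> R.
Proof.
rewrite expRN lef_pV2 ?posrE ?expR_gt0 //.
have -> : 2 = 2%:R * 1 :> R by rewrite mulr1.
rewrite expRM_natl (_ : 4 = 2 ^+ 2 :> R); last by ring.
rewrite lerXn2r ?nnegrE ?expR_ge0 //.
have := expR_ge1Dx (1 : R); lra.
Qed.

(** The single term of degree [n + 2] of the exponential series beats the left side, of degree
    [n + 1], past the stated threshold. *)
Lemma exp_beats_poly z gam n : 0 < gam -> 1 <= z ->
  4 * (n.+2)`!%:R * 2 ^+ n / gam ^+ n.+2 <= z ->
  4 * z * (2 * z) ^+ n <= expR (gam * z).
Proof.
move=> g0 z1 zbig; have z0 : 0 <= z by lra.
apply: le_trans (_ : (gam * z) ^+ n.+2 / n.+2`!%:R <= _); last first.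
  apply: le_trans (expR_ge1Dxn n.+1 _); last by rewrite mulr_ge0 // ltW.
  by rewrite lerDr.
rewrite ler_pdivlMr ?ltr0n ?fact_gt0 //.
move: zbig; rewrite ler_pdivrMr ?exprn_gt0 // => zbig.
have -> : 4 * z * (2 * z) ^+ n * n.+2`!%:R = (4 * n.+2`!%:R * 2 ^+ n) * z ^+ n.+1.
  by rewrite exprMn exprS; ring.
have -> : (gam * z) ^+ n.+2 = z * gam ^+ n.+2 * z ^+ n.+1 by rewrite exprMn (exprS z n.+1); ring.
by rewrite ler_wpM2r ?exprn_ge0.
Qed.

(** The counting factor is at most [Delta ^ 16], that is, [expR (16 * z)], and [b ^+ 3 / 2] exceeds
    [16 * z + 2] once [b >= 7]. *)
Lemma failure_prob_le (K Delta q : nat) z b : (K.+2 <= Delta)%N -> (q <= Delta ^ 2)%N ->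
  expR z = Delta%:R -> z <= b -> 7 <= b ->
  ((1 + Delta * K.+1) ^ 4 * (1 + q * K.+1 * q.+1))%:R * expR (- (b ^+ 3 / 2)) <= 4^-1.
Proof.
move=> KD qD zD zb b7; have D2 : (2 <= Delta)%N by apply: leq_trans KD.
have D0 : (0 < Delta)%N by apply: leq_trans D2.
have le16 : ((1 + Delta * K.+1) ^ 4 * (1 + q * K.+1 * q.+1) <= Delta ^ 16)%N.
  rewrite (expnD _ 8 8); apply: leq_mul.
    rewrite (expnM _ 2 4) leq_exp2r //; apply: (@leq_trans (Delta * K.+2)).
      by rewrite [X in (_ <= X)%N]mulnS leq_add2r.
    by rewrite expnS expn1 leq_mul2l KD orbT.
  apply: (@leq_trans (1 + Delta ^ 2 * Delta * (Delta ^ 3))).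
    rewrite leq_add2l; apply: leq_mul; first by rewrite leq_mul // ltnW.
    apply: (@leq_trans (Delta ^ 2).+1); first by rewrite ltnS.
    by rewrite ltn_exp2l.
  rewrite -expnSr -expnD; apply: (@leq_trans (Delta ^ 7)); last by rewrite leq_pexp2l.
  by rewrite add1n ltn_exp2l.
apply: (@le_trans _ _ ((Delta ^ 16)%:R * expR (- (b ^+ 3 / 2)))).
  by rewrite ler_wpM2r ?expR_ge0 // ler_nat.
apply: le_trans expRN2_le; rewrite natrX -zD -expRM_natl -expRD ler_expR.
have b2 : 49 <= b ^+ 2 by rewrite expr2; nra.
have b3 : 49 * b <= b ^+ 3 by rewrite exprSr ler_wpM2r //; lra.
lra.
Qed.

(* [K * lam <= (1 - gap) * log Delta], so the final lists have size about
   [Delta ^ (gap / K)], which beats the power [list_exponent K] of [log Delta]. *)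
Definition gap (delta : R) : R := delta / 2 / (1 + delta).

Definition list_exponent (K : nat) : nat := (6 * K + 17)%N.

(** A sum of positive terms, so that each lower bound needed on [ln Delta%:R] follows by dropping
    the others. The last term is the threshold of [exp_beats_poly]. *)
Definition large_log (K : nat) (delta : R) : R :=
  7 + 4 * K.+1%:R + K%:R * (1 + delta) + 4 * (2 + 20 * K%:R) / delta +
  2 * (2 + 20 * K%:R) + K%:R * (2 + 20 * K%:R) +
  4 * (list_exponent K * K).+2`!%:R * 2 ^+ (list_exponent K * K) /
    gap delta ^+ (list_exponent K * K).+2.

(** All parameters are powers of an integer [b] between [z] and [2 * z], up to constants: [M = b^3],
    [N = b^6], [eta = b^-7], [rho = b^-5], [lmin = b^E], [xi = a0 * b^-7]. The total drift
    [N * xi = a0 / b] is then small enough to be absorbed by [delta]. *)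
Lemma choosable_large_degree (K Delta q : nat) (delta : R) (V : finType) (H : {set {set V}}) :
  (0 < K)%N -> 0 < delta -> large_log K delta <= ln Delta%:R ->
  (1 + delta) * (K%:R * Delta%:R / ln Delta%:R) <= q%:R ^+ K -> (q <= Delta ^ 2)%N ->
  uniform K.+1 H -> uncrowded H -> (max_degree H <= Delta)%N -> choosable H q.
Proof.
move=> K0 d0; set z := ln Delta%:R => zlarge qlow qhigh uniH uncrH degH.
apply: choosable_finite_lists => C L0 L0q.
set E := list_exponent K; set gam := gap delta.
have K1 : 1 <= K%:R :> R by rewrite ler1n.
pose a0 : R := 2 + 20 * K%:R.
have a00 : 22 <= a0 by rewrite /a0; lra.
have gam0 : 0 < gam by rewrite /gam /gap !divr_gt0 //; lra.
have t1 : 0 < K%:R * (1 + delta) by rewrite mulr_gt0 //; lra.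
have t2 : 0 < 4 * a0 / delta by rewrite divr_gt0 //; lra.
have t3 : 0 < K%:R * a0 by rewrite mulr_gt0 //; lra.
have t4 : 0 < 4 * (E * K).+2`!%:R * 2 ^+ (E * K) / gam ^+ (E * K).+2 :> R.
  apply: divr_gt0; last exact: exprn_gt0.
  by apply: mulr_gt0; rewrite ?exprn_gt0 // mulr_gt0 // ltr0n fact_gt0.
rewrite /large_log -/E -/gam -/a0 in zlarge.
set G := 4 * _ * _ / _ in t4 zlarge.
have K4 : 0 < 4 * K.+1%:R :> R by rewrite mulr_gt0.
have z7 : 7 <= z by lra.
have zG : G <= z by lra.
have zK1 : 4 * K.+1%:R <= z by lra.
have zKd : K%:R * (1 + delta) <= z by lra.
have zad : 4 * a0 / delta <= z by lra.
have za : 2 * a0 <= z by lra.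
have zKa : K%:R * a0 <= z by lra.
clear zlarge t4 K4.
have z0 : 0 < z by lra.
have D0 : 0 < Delta%:R :> R by rewrite ltNge; apply/negP => /ln0; rewrite -/z; lra.
have zD : expR z = Delta%:R by rewrite lnK.
pose B := (Num.truncn z).+1; pose b : R := B%:R.
have [zb bz] : z <= b /\ b <= 2 * z.
  have /andP[] := truncn_itv (ltW z0); rewrite -/B -/b => h1 h2; split; first exact: ltW.
  by rewrite /b /B -natr1; lra.
have b7 : 7 <= b by lra.
have b0 : 0 < b by lra.
have bn0 : b != 0 by rewrite gt_eqF.
have bpow n m : (n <= m)%N -> (b ^+ m)^-1 <= (b ^+ n)^-1.
  by move=> nm; rewrite lef_pV2 ?posrE ?exprn_gt0 // ler_weXn2l //; lra.
have bpow1 n : b <= b ^+ n.+1 by rewrite -{1}[b]expr1 ler_weXn2l //; lra.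
have ibpos n : 0 < (b ^+ n)^-1 by rewrite invr_gt0 exprn_gt0.
pose a := a0 / b.
have a_ge0 : 0 <= a by rewrite divr_ge0 //; clear - a00 b0; lra.
have a_le2 : a <= 2^-1 by rewrite ler_pdivrMr //; clear - za zb; lra.
have a_led : 2 * a <= delta / 2.
  have : 4 * a0 <= b * delta by rewrite -ler_pdivrMr //; clear - zad zb; lra.
  rewrite mulrA ler_pdivrMr //; clear; lra.
have Ka1 : K%:R * a <= 1 by rewrite mulrA ler_pdivrMr //; clear - zKa zb; lra.
(* Chosen so that [qlow] becomes [Delta%:R <= lam0 * q%:R ^+ K], while [K%:R * lam0] stays below [z]
   by the factor [1 + delta]. *)
pose lam0 := z / (K%:R * (1 + delta)).
have lam01 : 1 <= lam0 by rewrite ler_pdivlMr // mul1r.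
pose xi := a0 / b ^+ 7.
have MN : (B ^ 3 * B ^ 3)%N%:R = b ^+ 6 :> R by rewrite -expnD natrX.
have Nxi : (B ^ 3 * B ^ 3)%N%:R * xi = a by rewrite MN /xi /a; field.
pose Lam := lam0 * expR a.
have Lam_ge0 : 0 <= Lam by rewrite mulr_ge0 ?expR_ge0 // (le_trans _ lam01).
have ea : expR a <= 1 + delta / 2.
  by apply: le_trans (expR_le1D2x _) _; [rewrite a_ge0 | clear - a_led; lra].
(* The drift uses up [1 + delta / 2] of the factor [1 + delta]; what remains is exactly
   [gap delta]. *)
have KLam : K%:R * Lam <= z - gam * z.
  have -> : z - gam * z = (K%:R * lam0) * (1 + delta / 2).
    rewrite /gam /gap /lam0; clear - d0 K1; field; apply/andP; split; lra.
  by rewrite /Lam mulrA ler_wpM2l // mulr_ge0 // (le_trans _ lam01).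
have KLamb : K%:R * Lam <= b.
  have : 0 < gam * z by rewrite mulr_gt0.
  clear - KLam zb; lra.
have bE : (b ^+ E)^-1 <= (b ^+ 7)^-1 by apply: bpow; apply: (@leq_trans 17%N) => //; exact: leq_addl.
apply: (@nibble_coloring R K V C H uniH uncrH L0 Delta q (b ^+ 7)^-1 xi (b ^+ 5)^-1
  (b ^+ E) (b ^+ 6)^-1 (b ^+ 3 / 2) degH K0 _ _ _ _ _ _ (B ^ 3)%N (B ^ 3 * B ^ 3)%N lam0 Lam) => //.
- have := bpow1 6; rewrite -[_ <= 4^-1]/(_^-1 <= 4^-1) lef_pV2 ?posrE ?exprn_gt0 //; clear - b7; lra.
- have := bpow1 4; rewrite lef_pV2 ?posrE ?exprn_gt0 //; clear - b7; lra.
- by have := bpow1 (6 * K + 16)%N; rewrite -addnS -/E; clear - b7; lra.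
- apply: (failure_prob_le _ qhigh zD zb b7); rewrite -(ler_nat R) -zD.
  by apply: le_trans (expR_ge1Dx z); rewrite -!natr1 in zK1 *; clear - zK1 K1; lra.
- rewrite -(ler_nat R) natrX; have := bpow1 2; rewrite -/b; clear - b7; lra.
- by rewrite MN.
- have : lam0 * ((1 + delta) * (K%:R * Delta%:R / z)) <= lam0 * q%:R ^+ K.
    by rewrite ler_wpM2l // (le_trans _ lam01).
  have -> // : lam0 * ((1 + delta) * (K%:R * Delta%:R / z)) = Delta%:R.
  by rewrite /lam0; clear - d0 K1 z0; field; apply/and3P; split; lra.
- exact: lt_le_trans lam01.
- by rewrite Nxi.
- have -> : Lam * (K%:R / b ^+ 6) = (K%:R * Lam) / b ^+ 6 by ring.
  rewrite ler_pdivrMr ?exprn_gt0 //.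
  by have -> : (b ^+ 5)^-1 * b ^+ 6 = b by field.
(* Compared in [K]-th powers: [q^K] is at least [expR z / z], and the shrinking factor is at least
   [expR (- (z - gam * z) - 1)]. The remaining [expR (gam * z) / (4 * z)] is at least
   [b^(E * K)]. *)
- rewrite Nxi -(@ler_pXn2r _ K) ?nnegrE ?mulr_ge0 ?expR_ge0 ?exprn_ge0 ?(ltW b0) //.
  rewrite -exprM exprMn -expRM_natl.
  have h1 : b ^+ (E * K) <= (2 * z) ^+ (E * K).
    by rewrite lerXn2r // nnegrE; clear - b0 bz; lra.
  have h2 := exp_beats_poly gam0 (_ : 1 <= z) zG.
  have {}h2 : 4 * z * b ^+ (E * K) <= expR (gam * z).
    by apply: le_trans (h2 _); [rewrite ler_wpM2l // mulr_ge0 // ltW | clear - z7; lra].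
  have h3 : expR z / z <= q%:R ^+ K.
    apply: le_trans qlow; rewrite zD mulrA ler_wpM2r ?invr_ge0 ?(ltW z0) //.
    rewrite mulrA -[X in X <= _]mul1r ler_wpM2r ?(ltW D0) // -[X in X <= _]mul1r.
    by apply: ler_pM => //; clear - d0; lra.
  have h4 : expR (- (z - gam * z)) * expR (- 1) <= expR (K%:R * - (Lam + a)).
    by rewrite -expRD ler_expR; clear - KLam Ka1; lra.
  apply: le_trans (_ : expR z / z * (expR (- (z - gam * z)) * expR (- 1)) <= _); last first.
    by apply: ler_pM; rewrite // ?mulr_ge0 ?expR_ge0 ?invr_ge0 // ltW.
  have -> : expR z / z * (expR (- (z - gam * z)) * expR (- 1)) =
      (expR z * expR (- (z - gam * z))) / z * expR (- 1) by ring.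
  rewrite -expRD (_ : z + _ = gam * z); last by ring.
  apply: le_trans (_ : expR (gam * z) / z * 4^-1 <= _); last first.
    by rewrite ler_wpM2l ?expRN1_ge // divr_ge0 ?expR_ge0 // ltW.
  rewrite -mulrA -invfM ler_pdivlMr; last by rewrite mulr_gt0.
  by rewrite mulrC (mulrC z).
(* Each error in the bracket is at most a multiple of [b^-7]; the multiples add up to 1 + 4 + 4 + 3
   + 8 = 20, whence [a0 = 2 + 20 * K]. *)
- rewrite natrX -/b /xi /a0.
  set iE := (b ^+ E)^-1 in bE *; set i7 := (b ^+ 7)^-1 in bE *.
  have i70 : 0 < i7 by exact: ibpos.
  have iE0 : 0 < iE by exact: ibpos.
  have i31 : (b ^+ 3)^-1 <= 1 by have := bpow 0%N 3%N isT; rewrite expr0 invr1.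
  have i51 : (b ^+ 5)^-1 <= 1 by have := bpow 0%N 5%N isT; rewrite expr0 invr1.
  have p1 : (b ^+ 3)^-1 * iE <= i7.
    by rewrite -[X in _ <= X]mul1r; apply: ler_pM => //; exact: ltW.
  have p2 : (b ^+ 3)^-1 * (b ^+ 5)^-1 <= i7 by rewrite -invfM -exprD; apply: bpow.
  have p3 : i7 * (b ^+ 5)^-1 <= i7.
    by rewrite -[X in _ <= X]mulr1; apply: ler_pM => //; exact: ltW.
  have p4 : (b ^+ 5)^-1 ^+ 2 <= i7 by rewrite exprVn -exprM; apply: bpow.
  have -> : (2 + 20 * K%:R) * i7 = 2 * i7 + K%:R * (20 * i7) by ring.
  rewrite lerD2l ler_wpM2l //.
  have -> : 4 / b ^+ 3 * (iE + (b ^+ 5)^-1) =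
    4 * ((b ^+ 3)^-1 * iE) + 4 * ((b ^+ 3)^-1 * (b ^+ 5)^-1) by ring.
  clear - bE p1 p2 p3 p4; lra.
(* The origin of [E = 6 * K + 17]: [eta ^+ 2] costs [b^14] and [h ^+ K] costs [b^(6 * K)], which
   leaves [b^3]. *)
- have -> : (b ^+ 7)^-1 ^+ 2 * (lam0 * (b ^+ 6)^-1 ^+ K * (b ^+ E / 2)) = lam0 * (b ^+ 3 / 2).
    rewrite /E /list_exponent exprD exprM !exprVn; clear - bn0; field.
    by rewrite ?expf_neq0 //; rewrite exprM expf_neq0 // expf_neq0.
  by rewrite -[X in X <= _]mul1r ler_wpM2r // divr_ge0 ?exprn_ge0 // ltW.
- rewrite natrX -/b mulrA ler_pdivrMr ?exprn_gt0 //.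
  apply: (@le_trans _ _ (b / 4 * b)).
    apply: ler_pM => //; last by rewrite ler_pdivlMr //; clear - zK1 zb; lra.
    by rewrite mulr_ge0.
  have -> : b / 4 * b = 4^-1 * b ^+ 2 by ring.
  rewrite ler_wpM2l // ?ler_weXn2l //; clear - b7; lra.
Qed.
End Asymptotics.

Theorem theorem1p5 (R : realType) (k : nat) (hk : (2 <= k)%N)
    (eps : R) (heps : 0 < eps) :
  exists Delta0 : nat, forall Delta : nat, (Delta0 <= Delta)%N ->
    forall (n : nat) (V : finType) (H : {set {set V}}),
      #|V| = n -> uniform k H -> uncrowded H -> (max_degree H <= Delta)%N ->
      (list_chromatic_number H)%:R <=
        (1 + eps) *
          ((k%:R - 1) * (Delta%:R / ln Delta%:R)) `^ (1 / (k%:R - 1)) :> R.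
Proof.
case: k hk => // K; rewrite ltnS => K0.
have -> : K.+1%:R - 1 = K%:R :> R by rewrite -natr1 addrK.
(* The other half of [eps] pays for rounding down: once [delta * p >= 1], [(1 + eps) * p - 1] is
   still at least [(1 + delta) * p]. *)
pose delta := eps / 2; have d0 : 0 < delta by rewrite divr_gt0.
(* The second argument of the maximum ensures [delta * p >= 1] and [q <= Delta ^ 2]. *)
pose Z := Num.max (large_log K delta) (2 * (delta^-1) ^+ K + K%:R + eps + 1).
exists (Num.truncn (expR Z)).+1 => Delta DeltaZ n V H _ uniH uncrH degH.
have ZD : expR Z < Delta%:R by apply: lt_le_trans (truncnS_gt _) _; rewrite ler_nat.
have D0 : 0 < Delta%:R :> R by apply: lt_trans ZD; rewrite expR_gt0.
set z := ln Delta%:R.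
have zZ : Z <= z by rewrite -[Z]expRK ler_ln ?posrE ?expR_gt0 // ltW.
have zD : expR z = Delta%:R by rewrite lnK.
have zlarge : large_log K delta <= z by apply: le_trans zZ; rewrite le_max lexx.
have : 2 * (delta^-1) ^+ K + K%:R + eps + 1 <= z by apply: le_trans zZ; rewrite le_max lexx orbT.
have idK : 0 < (delta^-1) ^+ K by rewrite exprn_gt0 ?invr_gt0.
have K1 : 1 <= K%:R :> R by rewrite ler1n.
move: zlarge => /[swap] zbig zlarge.
have [z1 zK zeps zd] : [/\ 1 <= z, K%:R <= z, eps <= z & 2 * (delta^-1) ^+ K <= z].
  by split; lra.
have z0 : 0 < z by lra.
have D1z : 1 + z <= Delta%:R by rewrite -zD expR_ge1Dx.
have Dzz : z ^+ 2 / 2 <= Delta%:R.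
  by rewrite -zD; apply: le_trans (expR_ge1Dxn 1 (ltW z0)); rewrite lerDr.
set P := K%:R * (Delta%:R / z); set p := P `^ (1 / K%:R).
have P0 : 0 <= P by rewrite mulr_ge0 ?divr_ge0 // ltW.
have p0 : 0 <= p by exact: powR_ge0.
have pK : p ^+ K = P.
  by rewrite -powR_mulrn // /p -powRrM div1r mulVf ?powRr1 // pnatr_eq0 -lt0n.
have PD : P <= Delta%:R.
  by rewrite /P mulrCA -[X in _ <= X]mulr1 ler_wpM2l ?(ltW D0) // ler_pdivrMr // mul1r.
have Pd : (delta^-1) ^+ K <= P.
  have : z / 2 <= Delta%:R / z by rewrite ler_pdivlMr // mulrAC -expr2.
  have : 1 * (Delta%:R / z) <= P by rewrite ler_wpM2r // divr_ge0 // ltW.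
  lra.
have pd : 1 <= delta * p.
  have : delta^-1 <= p by rewrite -(@ler_pXn2r _ K) ?nnegrE ?invr_ge0 ?(ltW d0) // pK.
  by rewrite -ler_pdivrMl // mulr1.
have pD : p <= Delta%:R.
  rewrite -(@ler_pXn2r _ K) ?nnegrE ?(ltW D0) // pK (le_trans PD) //.
  by rewrite -{1}[Delta%:R]expr1 ler_weXn2l //; lra.
have Y0 : 0 <= (1 + eps) * p by rewrite mulr_ge0 //; lra.
set q := Num.truncn ((1 + eps) * p).
have [qY Yq] : q%:R <= (1 + eps) * p /\ (1 + eps) * p <= q%:R + 1.
  by have /andP[h1 h2] := truncn_itv Y0; split=> //; rewrite natr1 ltW.
suff qch : choosable H q.
  apply: le_trans qY; rewrite ler_nat.
  (* Edges have at least two vertices, so the list chromatic number is not the default value 0. *)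
  have [|_] := @list_chromatic_numberP V H; last exact.
  by move=> e /uniH ->.
apply: (choosable_large_degree K0 d0 zlarge _ _ uniH uncrH degH).
  apply: (@le_trans _ _ (((1 + delta) * p) ^+ K)); last first.
    rewrite lerXn2r // ?nnegrE ?mulr_ge0 //; first lra.
    have : eps = 2 * delta by rewrite /delta; field.
    move=> e; rewrite e in Yq; lra.
  rewrite exprMn pK /P -mulrA ler_wpM2r // -{1}[1 + delta]expr1 ler_weXn2l //; lra.
rewrite -(ler_nat R) natrX expr2; apply: le_trans qY _.
by apply: ler_pM => //; lra.
Qed.
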